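(* Let $p$ be a prime and $q=p^4$. Let $k$ be a positive divisor of $4$, $v\ge 1$ a divisor of $p^k-1$, and let $\mathcal{U}\subseteq\mathbb{F}_q$ be an $\mathbb{F}_{p^k}$-vector space of dimension $m$ such that $1\in\mathcal{U}$ and $\#\mathcal{U}^v>2$. If $\mathcal{U}$ is not a field, then $\mathcal{P}(\mathcal{U}^v,q)=\{f^v : f\in\mathcal{P}(\mathcal{U},q)\}$. Otherwise, $$\mathcal{P}(\mathcal{U}^v,q)=\left\{f^{\frac{(p^e-1)v}{p^{mk}-1}} : f\in\mathcal{P}(\mathbb{F}_{p^e},q)\right\},$$ where $\mathbb{F}_{p^e}\subseteq\mathbb{F}_q$ is the smallest field containing $\mathcal{U}^v$.
   Context: For $F\in\mathbb{F}_q[x]$, $V_F=\{F(\alpha):\alpha\in\mathbb{F}_q\}$. A polynomial $F\in\mathbb{F}_q[x]$ of positive degree is a minimal value set polynomial (MVSP) over $\mathbb{F}_q$ if $\#V_F=\lfloor (q-1)/\deg F\rfloor+1$. For a nonempty $S\subseteq\mathbb{F}_q$, $\mathcal{P}(S,q)$ denotes the set of all MVSPs $F\in\mathbb{F}_q[x]$ with $V_F=S$, and for an integer $v\ge1$, $S^v=\{s^v: s\in S\}$. *)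

(* Defs.v *)
From mathcomp Require Import all_boot all_fingroup all_algebra all_field.

Set Implicit Arguments.
Unset Strict Implicit.
Unset Printing Implicit Defensive.

Import GRing.Theory.
Local Open Scope ring_scope.

Section ValueSets.
Variable F : finFieldType.

Definition value_set (f : {poly F}) : {set F} := [set f.[x] | x in F].

(* deg f = (size f).-1, so 1 < size f means that f has positive degree. *)
Definition mvsp (f : {poly F}) : Prop :=
  (1 < size f)%N /\ #|value_set f| = ((#|F| - 1) %/ (size f).-1 + 1)%N.

Definition mvsp_on (S : {set F}) (f : {poly F}) : Prop :=
  mvsp f /\ value_set f = S.

Definition set_exp (S : {set F}) (v : nat) : {set F} := [set s ^+ v | s in S].

End ValueSets.

Section PrimeSubspaces.
Variables (F : finFieldType) (p : nat) (charFp : p \in [pchar F]).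

(* pPrimeCharType charFp is F with its structure of field extension of 'F_p;
   its {vspace _} and {subfield _} are the additive subgroups and the subfields
   of F, and \dim is the dimension over 'F_p. *)
Local Notation L := (pPrimeCharType charFp).

Definition set_of_vspace (U : {vspace L}) : {set F} := [set x : F | (x : L) \in U].

(* The smallest subfield of F that contains S; 1%VS is the prime field, and over
   a finite field generated subalgebras are fields. *)
Definition subfield_gen (S : {set F}) : {subfield L} :=
  <<1 & (enum S : seq L)>>%AS.

End PrimeSubspaces.

(* Main.v *)
(** Let g be a minimal value set polynomial with value set S = U^v, #S = r + 1, and
    let L be the product of the X - a over the roots a of g in F_q. Counting the
    points where g does not vanish gives a differential equation for g; Lagrange
    interpolation turns it into L h(g) = c (X^q - X) L', where X h(X) vanishes on S, and
    it follows that L + (X^q - X) L' is the p-th power of some R + X^(q/p) Q with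
    L = R^p + X Q^p.

    If U is not a field, then k = 1 and dim U is 2 or 3, h comes from the linearized
    polynomial annihilating U, and comparing degrees leaves only g = c L^v.

    If U is a field, then h = X^r - 1. Taking p-th roots repeatedly gives t with
    g = L^v Y^(p^t), 1 + v r = p^t and L Y^r = R + X^(q/p^t) Q, L = R^(p^t) + X Q^(p^t).
    For t >= 2 degrees force Y to be constant or g to be a power of a linear
    polynomial. For t = 1 write Y = H^v Psi with Psi free of v-th powers: then
    a = H R and b = H Q satisfy a + X^(q/p) b = Psi^r (a^p + X b^p). A twisted second
    derivative, of too small degree not to vanish, splits a and b in the same way, and
    so on forever, while each splitting divides the weight v deg + deg Psi by p;
    hence Psi is constant. *)

Require Import Defs.
From Stdlib Require Import Classical_Prop.
From mathcomp Require Import all_boot all_fingroup all_algebra all_field.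
From mathcomp Require Import zify ring.

Set Implicit Arguments.
Unset Strict Implicit.
Unset Printing Implicit Defensive.

Import GRing.Theory.
Local Open Scope ring_scope.

(** Only one implication is hard: g is a constant times a power. The constant disappears because g
    takes the value 1, and the rest is counting with #S = r + 1. The polynomial h has the form a0 +
    X^w b^p with w v = -1 modulo p, so v X h' = a0 - h. This relation makes the equation for g close
    up and gives L g' = v g L'. As L is squarefree, it integrates to g = L^v Y^p, with v reduced
    modulo p. The obstacle is the factor Y, which derivatives do not see; everything afterwards
    serves to control Y. The value q = p^4 matters twice: it limits the dimension of a U that is not
    a field, and it gives p^(4-t) <= p^t for t >= 2, so that the degree argument fails only for t =
    1. There the degrees do leave room for a nonconstant Psi, whence an infinite descent. In the
    field case the exponent sought is w = (p^e - 1)/r, whereas the p-th roots yield v = (p^t - 1)/r;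
    minimality of F_(p^e) makes w divide v. *)

(** * Degree arithmetic for polynomials *)

Section PolynomialDegrees.
Variable F : fieldType.
Implicit Types a b d : {poly F}.

(** The same expression as in [mvsp]; the zero polynomial gets degree 0, so that upper bounds for
    sums and products need no side condition. *)
Definition deg a : nat := (size a).-1.

Lemma size_deg a : a != 0 -> size a = (deg a).+1.
Proof. by move=> a0; rewrite /deg prednK // size_poly_gt0. Qed.

Lemma deg0 : deg 0 = 0%N.
Proof. by rewrite /deg size_poly0. Qed.

Lemma deg_polyC (c : F) : deg c%:P = 0%N.
Proof. by rewrite /deg size_polyC; case: (c != 0). Qed.

Lemma deg_le_size a m : (deg a <= m)%N = (size a <= m.+1)%N.
Proof. by rewrite /deg; case: (size a). Qed.

Lemma deg_mul a b : a != 0 -> b != 0 -> deg (a * b) = (deg a + deg b)%N.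
Proof.
move=> a0 b0; have e : size (a * b) = (size a + size b).-1 := size_mul a0 b0; rewrite (size_deg a0) (size_deg b0) in e.
by rewrite {1}/deg e; lia.
Qed.

Lemma deg_expr a n : deg (a ^+ n) = (n * deg a)%N.
Proof. by rewrite /deg size_exp mulnC. Qed.

Lemma degN a : deg (- a) = deg a.
Proof. by rewrite /deg size_polyN. Qed.

Lemma deg_add_le a b m : (deg a <= m -> deg b <= m -> deg (a + b) <= m)%N.
Proof.
rewrite !deg_le_size => ha hb; apply: leq_trans (size_polyD a b) _.
by rewrite geq_max ha hb.
Qed.

Lemma deg_sub_le a b m : (deg a <= m -> deg b <= m -> deg (a - b) <= m)%N.
Proof. by move=> ? ?; apply: deg_add_le; rewrite ?degN. Qed.

Lemma deg_mul_le a b m n : (deg a <= m -> deg b <= n -> deg (a * b) <= m + n)%N.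
Proof.
have [->|a0] := eqVneq a 0; first by rewrite mul0r deg0.
have [->|b0] := eqVneq b 0; first by rewrite mulr0 deg0.
by rewrite deg_mul //; lia.
Qed.

Lemma deg_natmul_le a n : (deg (a *+ n) <= deg a)%N.
Proof. by elim: n => [|n IH]; rewrite ?deg0 // mulrS; apply: deg_add_le. Qed.

Lemma deg_add_eq a b : (deg b < deg a)%N -> deg (a + b) = deg a.
Proof.
move=> h; rewrite /deg size_polyDl //.
by move: h; rewrite /deg; case: (size a) => //; case: (size b).
Qed.

Lemma deg_scale (c : F) a : c != 0 -> deg (c *: a) = deg a.
Proof. by move=> c0; rewrite /deg size_scale. Qed.

Lemma deg_deriv a : a^`() != 0 -> (deg a^`() < deg a)%N.
Proof.
move=> da0; have a0 : a != 0 by apply: contra_neq da0 => ->; rewrite deriv0.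
by have := lt_size_deriv a0; rewrite (size_deg a0) (size_deg da0).
Qed.

Lemma deg_deriv_le a : (deg a^`() <= (deg a).-1)%N.
Proof.
have [->|/deg_deriv] := eqVneq a^`() 0; first by rewrite deg0.
by lia.
Qed.

Lemma deg_gt0_neq0 a : (0 < deg a)%N -> a != 0.
Proof. by apply: contraTneq => ->; rewrite deg0. Qed.

Lemma deg0_polyC a : deg a = 0%N -> a = (a`_0)%:P.
Proof. by move=> h; apply: size1_polyC; move: h; rewrite /deg; case: (size a) => // -[]. Qed.

Lemma deg_dvdp a b : b != 0 -> a %| b -> (deg a <= deg b)%N.
Proof.
move=> b0 ab; have a0 : a != 0 by apply: contraNneq b0 => a0; rewrite a0 dvd0p in ab.
by have := dvdp_leq b0 ab; rewrite (size_deg a0) (size_deg b0).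
Qed.

Lemma deg_lt_dvdp a b : (deg b < deg a)%N -> a %| b -> b = 0.
Proof.
by move=> h ab; apply/eqP; apply: contraTT h => b0; rewrite -leqNgt deg_dvdp.
Qed.

Lemma deg_mulX a : a != 0 -> deg ('X * a) = (deg a).+1.
Proof.
by move=> a0; rewrite deg_mul ?polyX_eq0 // {1}/deg size_polyX.
Qed.

Lemma deg_mulXn a n : a != 0 -> deg ('X^n * a) = (n + deg a)%N.
Proof.
by move=> a0; rewrite deg_mul ?expf_neq0 ?polyX_eq0 // {1}/deg size_polyXn.
Qed.

(* The two summands cannot cancel, their degrees being distinct modulo P. *)
Lemma deg_expr_addX a b P : (1 < P)%N ->
  [/\ (P * deg a <= deg (a ^+ P + 'X * b ^+ P))%N,
      b != 0 -> (P * deg b + 1 <= deg (a ^+ P + 'X * b ^+ P))%N &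
      a ^+ P + 'X * b ^+ P = 0 -> a = 0 /\ b = 0].
Proof.
move=> P1; have P0 : (0 < P)%N by lia.
have [->|b0] := eqVneq b 0.
  rewrite expr0n -[(P == 0)%N]negbK -lt0n P0 mulr0 addr0 deg_expr; split=> //.
  by move/eqP; rewrite expf_eq0 => /andP[_ /eqP].
have db : deg ('X * b ^+ P) = (P * deg b).+1 by rewrite deg_mulX ?expf_neq0 ?deg_expr.
have [/eqP-> |a0] := boolP (a == 0).
  rewrite expr0n -[(P == 0)%N]negbK -lt0n P0 add0r db deg0; split=> //; try lia.
  by move=> e; have := db; rewrite e deg0.
have da : deg (a ^+ P) = (P * deg a)%N by rewrite deg_expr.
have [h|h] := leqP (deg a) (deg b).
  have e : deg (a ^+ P + 'X * b ^+ P) = (P * deg b).+1.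
    by rewrite addrC deg_add_eq ?db ?da //; nia.
  by split=> [|_|e0]; rewrite ?e; try nia; rewrite e0 deg0 in e.
have e : deg (a ^+ P + 'X * b ^+ P) = (P * deg a)%N.
  by rewrite deg_add_eq ?db ?da //; nia.
by split=> [|_|e0]; rewrite ?e; try nia; rewrite e0 deg0 in e; nia.
Qed.

Lemma deg_add_mulXn a b n : b != 0 -> (deg a < n + deg b)%N ->
  deg (a + 'X^n * b) = (n + deg b)%N.
Proof. by move=> b0 h; rewrite addrC deg_add_eq ?deg_mulXn. Qed.

(** All terms of X^n b have degree at least n, out of reach of a. This splits one equation into
    two. *)
Lemma add_mulXn_eq0 a b n : (deg a < n)%N -> a + 'X^n * b = 0 -> a = 0 /\ b = 0.
Proof.
move=> sa e; have [b0|b0] := eqVneq b 0; first by move: e; rewrite b0 mulr0 addr0.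
by have := deg_add_mulXn b0 (ltn_addr (deg b) sa); rewrite e deg0; lia.
Qed.

End PolynomialDegrees.

(** * Derivatives and p-th powers over a perfect field *)

Section PerfectCharacteristic.
Variables (F : fieldType) (p : nat).
Hypothesis charF : p \in [pchar F].
Variable rt : F -> F.
Hypothesis rtK : forall x, rt x ^+ p = x.
Implicit Types a b d s t : {poly F}.

Let pP : prime p. Proof. exact: pcharf_prime charF. Qed.
Let p_gt1 : (1 < p)%N. Proof. exact: prime_gt1. Qed.

Let charP : p \in [pchar {poly F}].
Proof. by rewrite pchar_poly. Qed.

Lemma poly_natr_eq0 m : (m%:R == 0 :> {poly F}) = (p %| m)%N.
Proof. by rewrite (dvdn_pcharf charP). Qed.

Lemma exprDp_poly n a b : (a + b) ^+ (p ^ n) = a ^+ (p ^ n) + b ^+ (p ^ n).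
Proof. by apply: exprDn_pchar; rewrite pnatX pnatE // charP. Qed.

Lemma exprNp_poly n a : (- a) ^+ (p ^ n) = - a ^+ (p ^ n).
Proof.
by apply/eqP; rewrite -addr_eq0 -exprDp_poly addNr expr0n expn_eq0 (gtn_eqF (prime_gt0 pP)).
Qed.

Lemma exprBp_poly n a b : (a - b) ^+ (p ^ n) = a ^+ (p ^ n) - b ^+ (p ^ n).
Proof. by rewrite exprDp_poly exprNp_poly. Qed.

Lemma exprp_inj_poly n a b : a ^+ (p ^ n) = b ^+ (p ^ n) -> a = b.
Proof.
move/eqP; rewrite -subr_eq0 -exprBp_poly expf_eq0 => /andP[_].
by rewrite subr_eq0 => /eqP.
Qed.

Lemma deriv_dvdp_expr a m : (p %| m)%N -> (a ^+ m)^`() = 0.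
Proof.
by move=> pm; rewrite deriv_exp -mulr_natr; move: pm; rewrite -poly_natr_eq0 => /eqP->; rewrite mulr0.
Qed.

Lemma deriv_exprp a n : (0 < n)%N -> (a ^+ (p ^ n))^`() = 0.
Proof. by move=> n0; rewrite deriv_dvdp_expr // dvdn_exp. Qed.

Lemma deriv0_exprp a : a^`() = 0 -> exists b, a = b ^+ p.
Proof.
move=> da; have coefN i : ~~ (p %| i)%N -> a`_i = 0.
  case: i => [|i]; first by rewrite dvdn0.
  move=> pi; have := congr1 (fun b : {poly F} => b`_i) da.
  rewrite coef_deriv coef0 -mulr_natr => /eqP; rewrite mulf_eq0 => /orP[/eqP //|].
  by rewrite -(dvdn_pcharf charF) (negPf pi).
(* Only coefficients whose index is divisible by p survive, so the root is taken coefficientwise. *)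
exists (\poly_(i < size a) rt a`_(p * i)).
rewrite poly_def -(pFrobenius_autE charP) rmorph_sum /=.
apply/polyP=> j; rewrite coef_sum.
under eq_bigr => i _.
  rewrite pFrobenius_autE exprZn rtK -exprM [(i * p)%N]mulnC coefZ coefXn; over.
have [|npj] := boolP (p %| j)%N; last first.
  rewrite coefN // big1 // => i _; case: eqP npj => [->|_ _]; last by rewrite mulr0.
  by rewrite dvdn_mulr.
case/dvdnP=> i; rewrite mulnC => ->; have pinj k : (p * i == p * k)%N = (i == k).
  by rewrite eqn_pmul2l // prime_gt0.
have [ia|ia] := ltnP i (size a).
  rewrite (bigD1 (Ordinal ia)) //= eqxx mulr1 big1 ?addr0 // => k ki.
  by rewrite pinj; case: eqP => [e|]; rewrite ?mulr0 //; case/eqP: ki; apply: val_inj.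
rewrite nth_default; last by apply: leq_trans ia _; rewrite leq_pmull // prime_gt0.
rewrite big1 // => k _; rewrite pinj.
by rewrite gtn_eqF ?mulr0 //; apply: leq_trans ia.
Qed.

Lemma deriv2_0_exprp a : a^`()^`() = 0 ->
  exists s t, a = s ^+ p + 'X * t ^+ p /\ a^`() = t ^+ p.
Proof.
move/deriv0_exprp => [t et].
have [s es] : exists s, a - 'X * t ^+ p = s ^+ p.
  apply: deriv0_exprp; rewrite derivB derivM derivX mul1r (deriv_dvdp_expr _ (dvdnn p)).
  by rewrite mulr0 addr0 et subrr.
by exists s, t; rewrite -es subrK.
Qed.

(** The difference of the two sides is again of the form s^p + X t^p, whose terms cannot cancel. *)
Lemma exprp_addX_inj s t s' t' :
  s ^+ p + 'X * t ^+ p = s' ^+ p + 'X * t' ^+ p -> s = s' /\ t = t'.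
Proof.
move=> e; have [_ _] := deg_expr_addX (s - s') (t - t') p_gt1.
have E a b : (a - b) ^+ p = a ^+ p - b ^+ p by have := exprBp_poly 1 a b; rewrite expn1.
rewrite !E mulrBr => /(_ ltac:(by rewrite addrACA e -opprD subrr)).
by case=> /eqP + /eqP; rewrite !subr_eq0 => /eqP-> /eqP->.
Qed.

(** A common factor of d / gcd(d, a) and a divides d twice, hence divides d', and is a unit. So d /
    gcd(d, a) is coprime to a; as it divides a^m, it is itself a unit. *)
Lemma dvdp_expr_separable d a m : coprimep d d^`() -> d %| a ^+ m -> d %| a.
Proof.
move=> /coprimepP cd dam; have [e ed] := dvdpP _ _ (dvdp_gcdl d a).
have gdvd k : k %| gcdp d a = (k %| d) && (k %| a) by rewrite dvdp_gcd.
have := dvdp_gcdr d a; move: (gcdp d a) ed gdvd => g ed gdvd ga.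
have ce : coprimep e a.
  apply/coprimepP => k ke ka.
  have kd : k %| d by rewrite ed dvdp_mulr.
  have kg : k %| g by rewrite gdvd kd.
  by apply: cd => //; rewrite ed derivM; apply: dvdp_add; [apply: dvdp_mull|apply: dvdp_mulr].
have e1 : e %| 1.
  have : e %| 1 * a ^+ m by rewrite mul1r (dvdp_trans _ dam) // ed dvdp_mulr.
  by rewrite Gauss_dvdpl ?coprimep_expr.
rewrite ed; apply: dvdp_trans ga.
by rewrite -[X in _ %| X]mul1r dvdp_mul.
Qed.

(* Since d is squarefree, a d^(p - m) is a p-th power divisible by d^p. *)
Lemma log_deriv_exprp a d m : (m < p)%N -> coprimep d d^`() ->
  d * a^`() = m%:R * (a * d^`()) -> exists b, a = d ^+ m * b ^+ p.
Proof.
move=> mp cd e; have d0 : d != 0.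
  by apply: contraTneq cd => ->; rewrite deriv0 coprimep0 -size_poly_eq1 size_poly0.
have [k ek] : exists k, p = (k.+1 + m)%N by exists (p - m).-1; lia.
have ekm : k.+1%:R = - m%:R :> {poly F}.
  by apply/eqP; rewrite -addr_eq0 -natrD -ek poly_natr_eq0.
have [z ez] : exists z, a * d ^+ k.+1 = z ^+ p.
  apply: deriv0_exprp; rewrite derivM deriv_exp -[_ *+ k.+1]mulr_natl ekm exprS.
  by rewrite mulrA [a^`() * d]mulrC e succnK; ring.
have dz : d %| z.
  by apply: (dvdp_expr_separable (m := p)) => //; rewrite -ez exprS mulrCA dvdp_mulIl.
move/dvdpP: dz => [b eb]; exists b.
apply: (mulIf (expf_neq0 k.+1 d0)).
by rewrite ez eb exprMn [in d ^+ p]ek exprD; ring.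
Qed.

End PerfectCharacteristic.

(** * Irreducible factors and divisibility by their powers *)

Section IrreducibleFactors.
Variable F : fieldType.
Implicit Types a b d : {poly F}.

Lemma irreducible_factor a : (0 < deg a)%N -> exists2 d, irreducible_poly d & d %| a.
Proof.
have [n] := ubnP (deg a); elim: n a => // n IH a an a0.
have [|H] := classic (exists2 d, (0 < deg d < deg a)%N & d %| a).
  move=> [d /andP[d0 da] dva].
  have [||e irr ed] := IH d; [exact: leq_trans da _|by []|].
  by exists e => //; apply: dvdp_trans dva.
have an0 := deg_gt0_neq0 a0.
exists a => //; split=> [|d d1 da]; first by rewrite size_deg.
have d0 : d != 0 by apply: contraNneq an0 => d0; rewrite d0 dvd0p in da.
rewrite size_deg // eqSS in d1.
rewrite -dvdp_size_eqp // !size_deg // eqSS eqn_leq deg_dvdp //= leqNgt.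
by apply/negP => dlt; apply: H; exists d; rewrite // lt0n d1.
Qed.

Lemma dvdp_multiplicity a d : (0 < deg d)%N -> a != 0 ->
  exists i b, a = d ^+ i * b /\ ~~ (d %| b).
Proof.
have [n] := ubnP (deg a); elim: n a => // n IH a an d0 a0.
have [/dvdpP[b eb]|nda] := boolP (d %| a); last first.
  by exists 0%N, a; rewrite expr0 mul1r.
have b0 : b != 0 by apply: contraNneq a0 => b0; rewrite eb b0 mul0r.
have [|i [c [ec nc]]] := IH b _ d0 b0.
  by move: an; rewrite eb deg_mul ?(deg_gt0_neq0 d0) //; lia.
by exists i.+1, c; rewrite eb {1}ec exprSr mulrAC.
Qed.

Lemma dvdp_exp_multiplicity d i j b : irreducible_poly d -> ~~ (d %| b) ->
  (d ^+ j %| d ^+ i * b) = (j <= i)%N.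
Proof.
move=> irr ndb; have d1 : (1 < size d)%N by case: irr.
have cb : coprimep (d ^+ j) b by rewrite coprimep_expl // irreducible_poly_coprime.
by rewrite Gauss_dvdpl // dvdp_Pexp2l.
Qed.

(** Induction on the degree strips a common irreducible factor d. If e is coprime to d, the power
    e^j passes to the quotient; if e is associated to d, the hypothesis is applied to e^(j+1). *)
Lemma dvdp_prime_powers a b : a != 0 ->
  (forall d j, irreducible_poly d -> d ^+ j %| a -> d ^+ j %| b) -> a %| b.
Proof.
have [n] := ubnP (deg a); elim: n a b => // n IH a b an a0 H.
have [/deg0_polyC ea|] := posnP (deg a).
  have u : a %= 1 by rewrite ea polyC_eqp1 -polyC_eq0 -ea.
  by rewrite (eqp_dvdl _ u) dvd1p.
move/irreducible_factor=> [d irr da].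
have db : d %| b by have := H d 1%N irr; rewrite expr1 => /(_ da).
have d0 : d != 0 := irredp_neq0 irr.
have dd : (0 < deg d)%N by case: irr; rewrite size_deg.
move/dvdpP: da H an a0 => [a' ->] H; move/dvdpP: db H => [b' ->] H.
rewrite mulf_eq0 negb_or => + /andP[a0 _]; rewrite deg_mul // => an.
rewrite dvdp_mul2r //; apply: IH => // [|e j ire ea]; first by lia.
have [de|nde] := boolP (d %| e); last first.
  have ce : coprimep (e ^+ j) d.
    by rewrite coprimep_expl // coprimep_sym irreducible_poly_coprime.
  by have := H e j ire (dvdp_mulr _ ea); rewrite Gauss_dvdpl.
have ed : e %| d.
  by case: ire => _ /(_ d); case: irr => /gtn_eqF-> _ /(_ isT de) /andP[_ ->].
have := H e j.+1 ire; rewrite exprSr => /(_ (dvdp_mul ea ed)) h.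
by rewrite -(dvdp_mul2r _ _ d0); apply: dvdp_trans h; rewrite dvdp_mul.
Qed.

End IrreducibleFactors.

(** * Twisted derivatives and infinite descent *)

Section TwistedDescent.
Variables (F : fieldType) (p : nat).
Hypothesis charF : p \in [pchar F].
Variable rt : F -> F.
Hypothesis rtK : forall x, rt x ^+ p = x.
Variables (v r : nat) (Psi : {poly F}).
Hypothesis rv : (r * v = p.-1)%N.
Hypothesis v1 : (1 < v)%N.
Hypothesis v2 : (2 * v <= p.-1)%N.
Hypothesis Psi0 : Psi != 0.
Hypothesis Psi_free : forall d, irreducible_poly d -> ~~ (d ^+ v %| Psi).
Implicit Types a b d s t u z : {poly F}.

Let pP : prime p. Proof. exact: pcharf_prime charF. Qed.
Let p_gt1 : (1 < p)%N. Proof. exact: prime_gt1. Qed.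
Let p_gt0 : (0 < p)%N. Proof. exact: prime_gt0. Qed.
Let r_gt0 : (0 < r)%N. Proof. by move: rv; case: (r) => //; rewrite mul0n; lia. Qed.
Let v_gt0 : (0 < v)%N. Proof. by move: rv; case: (v) => //; rewrite muln0; lia. Qed.
Let rp : (r < p.-1)%N. Proof. by move: rv v1 r_gt0 => /=; nia. Qed.

(** From d^j %| Psi follows j < v, so j r + r <= p - 1 and j (p - r) - 1 > (j - 1) p. The
    multiplicity of d in z^p is a multiple of p, hence at least j p. *)
Lemma dvdp_of_power z :
  (forall d j, irreducible_poly d -> d ^+ j %| Psi -> d ^+ (j * (p - r)).-1 %| z ^+ p) ->
  Psi %| z.
Proof.
move=> H; apply: dvdp_prime_powers => // d j irr dj.
have [->|z0] := eqVneq z 0; first exact: dvdp0.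
have d0 : (0 < deg d)%N by case: (irr); rewrite size_deg ?(irredp_neq0 irr).
have [i [b [ez nb]]] := dvdp_multiplicity d0 z0.
have jv : (j < v)%N.
  by rewrite ltnNge; apply/negP => /(dvdp_exp2l d) /dvdp_trans /(_ dj) /(negP (Psi_free irr)).
have := H d j irr dj; rewrite ez exprMn -exprM.
have nbp : ~~ (d %| b ^+ p).
  by rewrite -irreducible_poly_coprime // coprimep_expr // irreducible_poly_coprime.
rewrite !dvdp_exp_multiplicity // => h.
have jr : (j * r + r <= p.-1)%N by rewrite -rv addnC -mulSn mulnC leq_mul2l jv orbT.
by rewrite leqNgt; apply/negP => ij; move: h rp; rewrite mulnBr; nia.
Qed.

(* twisted_deriv n u is Psi^(n+1) times the derivative of u / Psi^n. *)
Definition twisted_deriv n u := Psi * u^`() - n%:R * (Psi^`() * u).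

(** The quotient u / Psi^r has the shape of a polynomial with zero second derivative. *)
Definition twisted u := exists s t, u = Psi ^+ r * (s ^+ p + 'X * t ^+ p).

Lemma twisted_deriv_addXn n m a b :
  (p %| m)%N -> twisted_deriv n (a + 'X^m * b) = twisted_deriv n a + 'X^m * twisted_deriv n b.
Proof.
move=> pm; rewrite /twisted_deriv !derivD !derivM (deriv_dvdp_expr charF 'X pm).
by ring.
Qed.

Lemma twisted_deriv_expr n m a : (p %| m)%N ->
  twisted_deriv n (Psi ^+ n * a ^+ m) = 0.
Proof.
move=> pm; rewrite /twisted_deriv derivM (deriv_dvdp_expr charF a pm) deriv_exp -mulr_natl.
by case: n => [|n]; rewrite /= ?mul0r ?exprS; ring.
Qed.

Lemma twisted_deriv2 u : twisted u -> twisted_deriv r.+1 (twisted_deriv r u) = 0.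
Proof.
move=> [s [t ->]]; have -> : twisted_deriv r (Psi ^+ r * (s ^+ p + 'X * t ^+ p)) = Psi ^+ r.+1 * t ^+ p.
  rewrite /twisted_deriv derivM derivD derivM derivX !(deriv_dvdp_expr charF _ (dvdnn p)).
  rewrite deriv_exp -mulr_natl.
  by move: r_gt0; case: (r) => // n _; rewrite /= ?exprS; ring.
exact: twisted_deriv_expr (dvdnn p).
Qed.

(* c Psi^(p-n) has zero derivative, hence is a p-th power; the last hypothesis makes its
   root divisible by Psi. *)
Lemma twisted_deriv_eq0 n c : (n < p)%N -> twisted_deriv n c = 0 ->
  (forall d j, irreducible_poly d -> d ^+ j %| Psi -> d ^+ (j * (p - r)).-1 %| c * Psi ^+ (p - n)) ->
  exists t, c = Psi ^+ n * t ^+ p.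
Proof.
move=> np dc H.
have [m em] : exists m, p = (m.+1 + n)%N by exists (p - n).-1; lia.
have emn : m.+1%:R = - n%:R :> {poly F}.
  by apply/eqP; rewrite -addr_eq0 -natrD -em (poly_natr_eq0 charF).
have epn : (p - n = m.+1)%N by lia.
have [z ez] : exists z, c * Psi ^+ m.+1 = z ^+ p.
  apply: (deriv0_exprp charF rtK).
  rewrite derivM deriv_exp -[_ *+ m.+1]mulr_natl emn exprS succnK.
  transitivity (Psi ^+ m * twisted_deriv n c); first by rewrite /twisted_deriv; ring.
  by rewrite dc mulr0.
have : Psi %| z.
  by apply: dvdp_of_power => d j irr dj; rewrite -ez; rewrite -epn; apply: H.
move/dvdpP=> [t et]; exists t.
apply: (mulIf (expf_neq0 m.+1 Psi0)).
by rewrite ez et exprMn mulrAC -exprD addnC -em mulrC.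
Qed.

(** Among rational functions, s and t exist as soon as the second derivative of u / Psi^r vanishes;
    that Psi has no v-th power factor clears their denominators. *)
Lemma twistedP u : twisted_deriv r.+1 (twisted_deriv r u) = 0 -> twisted u.
Proof.
move=> d2; have [|d j irr dj|t et] := twisted_deriv_eq0 _ d2; first by lia.
  (* the twisted derivative loses at most one power of each prime factor of Psi *)
  case: j dj => [|j] dj; first by rewrite mul0n expr0 dvd1p.
  have h1 : d ^+ j %| twisted_deriv r u.
    have /dvdpP[c ec] := dj.
    rewrite /twisted_deriv ec derivM deriv_exp succnK -[_ *+ j.+1]mulr_natl exprS.
    apply/dvdpP; exists (c * d * u^`() - r%:R * ((c^`() * d + c * (j.+1%:R * d^`())) * u)).
    by ring.
  have h2 : d ^+ (j.+1 * (p - r.+1)) %| Psi ^+ (p - r.+1) by rewrite exprM dvdp_exp2r.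
  have -> : ((j.+1 * (p - r)).-1 = j + j.+1 * (p - r.+1))%N.
    have -> : (p - r = (p - r.+1).+1)%N by lia.
    by rewrite mulnS addSn.
  by rewrite exprD dvdp_mul.
(* Once its X t^p part is removed, u has zero first twisted derivative. *)
have := twisted_deriv_eq0 (n := r) (c := u - Psi ^+ r * ('X * t ^+ p)).
case=> [||d j irr dj|s es]; first by lia.
- have -> : twisted_deriv r (u - Psi ^+ r * ('X * t ^+ p)) = 
      twisted_deriv r u - Psi ^+ r.+1 * t ^+ p.
    rewrite /twisted_deriv derivB !derivM derivX (deriv_dvdp_expr charF _ (dvdnn p)).
    rewrite deriv_exp -mulr_natl.
    by move: r_gt0; case: (r) => // n _; rewrite /= ?exprS; ring.
  by rewrite et subrr.
- apply/dvdp_mull/(@dvdp_trans _ (d ^+ (j * (p - r)))).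
    by rewrite dvdp_exp2l // leq_pred.
  by rewrite exprM dvdp_exp2r.
by exists s, t; rewrite mulrDr -es subrK.
Qed.

Hypothesis Psi_deg : (0 < deg Psi)%N.

(** A binary tree of decompositions of depth k: s and t are both decomposed again. *)
Fixpoint twisted_iter k u : Prop :=
  if k is k'.+1 then
    exists s t, [/\ u = Psi ^+ r * (s ^+ p + 'X * t ^+ p), twisted_iter k' s & twisted_iter k' t]
  else True.

Lemma twisted_iter0 k : twisted_iter k 0.
Proof.
elim: k => //= k IH; exists 0, 0; split=> //.
by rewrite expr0n (gtn_eqF p_gt0) mulr0 addr0 mulr0.
Qed.

Lemma deg_twisted s t : s ^+ p + 'X * t ^+ p != 0 ->
  (r * deg Psi + p * deg s <= deg (Psi ^+ r * (s ^+ p + 'X * t ^+ p)))%N /\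
  (t != 0 -> (r * deg Psi + p * deg t + 1 <= deg (Psi ^+ r * (s ^+ p + 'X * t ^+ p)))%N).
Proof.
move=> n0; rewrite deg_mul ?expf_neq0 // deg_expr.
by have [h1 h2 _] := deg_expr_addX s t p_gt1; split=> [|/h2]; lia.
Qed.

Lemma twisted_neq0 s t : Psi ^+ r * (s ^+ p + 'X * t ^+ p) != 0 -> s ^+ p + 'X * t ^+ p != 0.
Proof. by apply: contra_neq => ->; rewrite mulr0. Qed.

(* Each decomposition divides the weight v deg u + deg Psi by p. *)
Lemma twisted_iter_small k u : (v * deg u + deg Psi < p ^ k)%N -> twisted_iter k u -> u = 0.
Proof.
elim: k u => [|k IH] u; first by rewrite expn0; lia.
rewrite expnS => ku [s [t [eu hs ht]]].
have [//|u0] := eqVneq u 0; have := u0; rewrite {1}eu => /twisted_neq0 n0.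
have [ds dt] := deg_twisted n0; rewrite -eu in ds dt.
have s0 : s = 0.
  apply: IH hs; rewrite -(ltn_pmul2l p_gt0); apply: leq_ltn_trans ku.
  (* As v r + 1 = p, the degree bound times v reads p (v deg s + deg Psi) <= v deg u + deg Psi. *)
  have := leq_mul (leqnn v) ds.
  have : (p = p.-1.+1)%N by lia.
  by move: rv; move: (p.-1) (deg Psi) (deg s) (deg u) => m x y z <- ->; nia.
have t0 : t = 0.
  have [//|t0] := eqVneq t 0.
  apply: IH ht; rewrite -(ltn_pmul2l p_gt0); apply: leq_ltn_trans ku.
  have := leq_mul (leqnn v) (dt t0).
  have : (p = p.-1.+1)%N by lia.
  by move: rv; move: (p.-1) (deg Psi) (deg t) (deg u) => m x y z <- ->; nia.
by rewrite eu s0 t0 expr0n (gtn_eqF p_gt0) mulr0 addr0 mulr0.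
Qed.

(** An invariant for splitting a + X^(p^j) b. It passes from u at j + 1 to s and t at j, since u =
    Psi^r (s^p + X t^p) gives p ((p - 1) deg s + r deg Psi) <= (p - 1) deg u + r deg Psi; at j = 0
    it forces u = 0. *)
Definition weight_le j u := u != 0 -> (p.-1 * deg u + r * deg Psi <= (p ^ j).-1)%N.

Lemma weight_le0 u : weight_le 0 u -> u = 0.
Proof.
move=> h; have [//|/h] := eqVneq u 0; rewrite expn0 => h0.
have : (0 < r * deg Psi)%N by rewrite muln_gt0 r_gt0.
by lia.
Qed.

Lemma deg_twisted_deriv n u : (deg (twisted_deriv n u) <= deg u + deg Psi)%N.
Proof.
apply: deg_sub_le; first by rewrite addnC; apply: deg_mul_le => //; have := deg_deriv_le u; lia.
rewrite mulr_natl addnC; apply: leq_trans (deg_natmul_le _ _) _.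
by apply: deg_mul_le => //; have := deg_deriv_le Psi; lia.
Qed.

(** Two twisted derivatives raise the degree by at most 2 deg Psi <= r deg Psi, so the second one of
    a has degree below p^(j+1) and separates from that of X^(p^(j+1)) b. *)
Lemma twisted_split j a b : weight_le j.+1 a -> weight_le j.+1 b ->
  twisted (a + 'X^(p ^ j.+1) * b) -> twisted a /\ twisted b.
Proof.
move=> wa wb /twisted_deriv2.
have pj : (p %| p ^ j.+1)%N by rewrite expnS dvdn_mulr.
rewrite !twisted_deriv_addXn // => /add_mulXn_eq0[|da db]; last by split; apply: twistedP.
have pj0 : (0 < p ^ j.+1)%N by rewrite expn_gt0 p_gt0.
have [a0|/wa h] := eqVneq a 0.
  by rewrite a0 /twisted_deriv !(deriv0, mulr0, subr0, deg0).
have r2 : (1 < r)%N by move: v2 v1 r_gt0; rewrite -rv; nia.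
have h1 := deg_twisted_deriv r a; have h2 := deg_twisted_deriv r.+1 (twisted_deriv r a).
have h3 : (2 * deg Psi <= r * deg Psi)%N by rewrite leq_mul2r r2 orbT.
have h4 : (deg a <= p.-1 * deg a)%N by rewrite leq_pmull //; lia.
by lia.
Qed.

(** Decomposing a and b gives, by uniqueness, s = a0 + X^(p^j) b0 and t = a1 + X^(p^j) b1, where the
    exponent j and the depth k have both dropped by one. At j = 0 only a = b = 0 remains. *)
Lemma twisted_iter_split k j a b : weight_le j a -> weight_le j b ->
  twisted_iter k (a + 'X^(p ^ j) * b) -> twisted_iter k a /\ twisted_iter k b.
Proof.
elim: k j a b => // k IH [|j] a b wa wb.
  by move: wa wb => /weight_le0-> /weight_le0->; split; apply: twisted_iter0.
move=> [s [t [e hs ht]]].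
have tw : twisted (a + 'X^(p ^ j.+1) * b) by exists s, t.
have [[a0 [a1 ea]] [b0 [b1 eb]]] := twisted_split wa wb tw.
have P : (p ^ j.+1 = p ^ j * p)%N by rewrite expnSr.
have [es et] : s = a0 + 'X^(p ^ j) * b0 /\ t = a1 + 'X^(p ^ j) * b1.
  apply: (exprp_addX_inj charF); apply: (mulfI (expf_neq0 r Psi0)); rewrite -e ea eb P.
  have E x y : (x + 'X^(p ^ j) * y) ^+ p = x ^+ p + 'X^(p ^ j * p) * y ^+ p :> {poly F}.
    by have := exprDp_poly charF 1 x ('X^(p ^ j) * y); rewrite expn1 exprMn -exprM.
  by rewrite !E; ring.
have half x x0 x1 : x = Psi ^+ r * (x0 ^+ p + 'X * x1 ^+ p) -> weight_le j.+1 x ->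
    weight_le j x0 /\ weight_le j x1.
  move=> ex wx; have [n0|n0] := eqVneq (x0 ^+ p + 'X * x1 ^+ p) 0.
    have [_ _ /(_ n0)[-> ->]] := deg_expr_addX x0 x1 p_gt1.
    by split; rewrite /weight_le eqxx.
  have x_neq0 : x != 0 by rewrite ex mulf_neq0 ?expf_neq0.
  have := wx x_neq0; have [d0 d1] := deg_twisted n0; rewrite -ex in d0 d1 => {}wx.
  have key y : (r * deg Psi + p * deg y <= deg x)%N -> (p.-1 * deg y + r * deg Psi <= (p ^ j).-1)%N.
    move=> dy; suff : (p * (p.-1 * deg y + r * deg Psi) < p * p ^ j)%N.
      by rewrite ltn_pmul2l //; lia.
    rewrite -expnS; have := leq_mul (leqnn p.-1) dy.
    have pj0 : (0 < p ^ j.+1)%N by rewrite expn_gt0 p_gt0.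
    have eR : (p * (r * deg Psi) = p.-1 * (r * deg Psi) + r * deg Psi)%N.
      by rewrite -mulSnr prednK.
    by rewrite !mulnDr eR mulnCA; move: wx pj0; lia.
  split=> [_|y0]; apply: key => //.
  by have := d1 y0; lia.
have [wa0 wa1] := half a a0 a1 ea wa; have [wb0 wb1] := half b b0 b1 eb wb.
rewrite es in hs; rewrite et in ht.
have [ha0 hb0] := IH j a0 b0 wa0 wb0 hs; have [ha1 hb1] := IH j a1 b1 wa1 wb1 ht.
by split; [exists a0, a1|exists b0, b1].
Qed.

(* The relation makes a + X^(p^j) b decomposable to every depth. *)
Lemma twisted_fixpoint_eq0 j a b : weight_le j a -> weight_le j b ->
  a + 'X^(p ^ j) * b = Psi ^+ r * (a ^+ p + 'X * b ^+ p) -> a + 'X^(p ^ j) * b = 0.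
Proof.
move=> wa wb e; set u := a + _.
have H k : twisted_iter k u.
  elim: k => //= k /twisted_iter_split - /(_ wa wb)[ha hb].
  by exists a, b.
(* The weight itself serves as the depth, because k < p^k. *)
apply: (@twisted_iter_small (v * deg u + deg Psi)) => //.
exact: ltn_expl.
Qed.

End TwistedDescent.

(** * Repeated p-th roots of the equation for g *)

Section PowerStructure.
Variables (F : fieldType) (p : nat).
Hypothesis charF : p \in [pchar F].
Variable rt : F -> F.
Hypothesis rtK : forall x, rt x ^+ p = x.
Implicit Types a b g L Y R Q : {poly F}.

Let pP : prime p. Proof. exact: pcharf_prime charF. Qed.
Let p_gt1 : (1 < p)%N. Proof. exact: prime_gt1. Qed.
Let p_gt0 : (0 < p)%N. Proof. exact: prime_gt0. Qed.

Lemma natr_modp m : (m %% p)%N%:R = m%:R :> {poly F}.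
Proof.
rewrite [in RHS](divn_eq m p) natrD natrM.
have /eqP -> : p%:R == 0 :> {poly F} by rewrite (poly_natr_eq0 charF).
by rewrite mulr0 add0r.
Qed.

Lemma natr_eqm1 m : (p %| m.+1)%N -> m%:R = -1 :> {poly F}.
Proof. by rewrite -(poly_natr_eq0 charF) -addn1 natrD addr_eq0 => /eqP. Qed.

Lemma log_deriv_split w a L : coprimep L L^`() ->
  L * a^`() = w%:R * (a * L^`()) -> exists b, a = L ^+ (w %% p) * b ^+ p.
Proof.
move=> sepL e; apply: (log_deriv_exprp charF rtK) => //; first by rewrite ltn_mod.
by rewrite natr_modp.
Qed.

(** The derivative of L + (X^q - X) L' is (X^q - X) L'', so L'' = 0. *)
Lemma frobenius_split n L : (0 < n)%N ->
  (L + ('X^(p ^ n) - 'X) * L^`())^`() = 0 ->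
  exists R Q, [/\ L = R ^+ p + 'X * Q ^+ p, L^`() = Q ^+ p &
    L + ('X^(p ^ n) - 'X) * L^`() = (R + 'X^(p ^ n.-1) * Q) ^+ p].
Proof.
move=> n0 e.
have dX : ('X^(p ^ n) : {poly F})^`() = 0 by rewrite (deriv_exprp charF).
have X0 : 'X^(p ^ n) - 'X != 0 :> {poly F}.
  apply: contra_eq_neq dX => /eqP; rewrite subr_eq0 => /eqP->.
  by rewrite derivX oner_eq0.
have d2 : L^`()^`() = 0.
  apply: (mulfI X0); rewrite mulr0 -e derivD derivM derivB dX derivX; ring.
have [R [Q [eL eL']]] := deriv2_0_exprp charF rtK d2.
exists R, Q; split=> //.
have := exprDp_poly charF 1 R ('X^(p ^ n.-1) * Q); rewrite expn1 => ->.
by rewrite exprMn -exprM -expnSr prednK // eL' {1}eL; ring.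
Qed.

Variables (n r w : nat) (g L : {poly F}).
Hypothesis n_gt0 : (0 < n)%N.
Hypothesis r_gt1 : (1 < r)%N.
Hypothesis wr : (p %| (w * r).+1)%N.
Hypothesis g0 : g != 0.
Hypothesis sepL : coprimep L L^`().
Hypothesis degL : (0 < deg L < p ^ n)%N.
Hypothesis logL : L * g^`() = w%:R * (g * L^`()).
Hypothesis eqL : L * g ^+ r = L + ('X^(p ^ n) - 'X) * L^`().

(** The state after t roots: the first two clauses give L g^r = (L^tau Y^r)^(p^t), and R +
    X^(p^(n-t)) Q is the p^t-th root of L + (X^q - X) L'. The aim is tau = 1. *)
Definition power_structure t v tau := exists Y R Q,
  [/\ g = L ^+ v * Y ^+ (p ^ t), (1 + v * r = p ^ t * tau)%N,
      L ^+ tau * Y ^+ r = R + 'X^(p ^ (n - t)) * Q &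
      L = R ^+ (p ^ t) + 'X * Q ^+ (p ^ t)].

Let L0 : L != 0. Proof. by apply: deg_gt0_neq0; case/andP: degL. Qed.
Let dL0 : L^`() != 0.
Proof.
apply: contraTneq sepL => ->; rewrite coprimep0 -size_poly_eq1 size_deg //.
by case/andP: degL; case: (deg L).
Qed.

(** By [logL], the derivative of L g^r is (1 + w r) L' g^r, which vanishes by [wr]. *)
Lemma power_structure1 : exists v tau, power_structure 1 v tau.
Proof.
have d0 : (L * g ^+ r)^`() = 0.
  rewrite derivM deriv_exp -mulr_natl.
  have -> : (g ^+ r = g * g ^+ r.-1) by rewrite -exprS prednK // ltnW.
  transitivity (g ^+ r.-1 * (L^`() * g + r%:R * (L * g^`()))); first by ring.
  rewrite logL.
  transitivity (g ^+ r.-1 * (L^`() * g * (1 + (w * r)%:R))); first by rewrite natrM; ring.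
  by rewrite natr_eqm1 // subrr !mulr0.
rewrite eqL in d0; have [R [Q [eL eL' eC]]] := frobenius_split n_gt0 d0.
have [Y eg] := log_deriv_split sepL logL.
have /dvdnP[tau etau] : (p %| 1 + (w %% p) * r)%N.
  by rewrite /dvdn -modnDmr modnMml modnDmr.
exists (w %% p)%N, tau, Y, R, Q.
rewrite /power_structure expn1 subn1; split=> //; first by rewrite etau mulnC.
apply: (exprp_inj_poly charF (n := 1)); rewrite expn1 -eC -eqL eg.
rewrite !exprMn -!exprM [(r * p)%N]mulnC -etau add1n exprS mulrA.
by [].
Qed.

(* As soon as tau > 1, L divides C = R + X^M Q and C', hence Q R' - R Q', which has smaller degree. *)
Lemma power_structure_step t v tau : (0 < t < n)%N -> (1 < tau)%N ->
  power_structure t v tau -> exists v' tau', power_structure t.+1 v' tau'.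
Proof.
move=> /andP[t0 tn] tau1 [Y [R [Q [eg ev eC eL]]]].
have P1 : (1 < p ^ t)%N by apply: leq_trans p_gt1 _; rewrite -{1}(expn1 p) leq_exp2l.
set M := (p ^ (n - t))%N in eC.
have pM : (p %| M)%N by rewrite dvdn_exp // subn_gt0.
have dXM : ('X^M : {poly F})^`() = 0 by rewrite (deriv_dvdp_expr charF).
have eL' : L^`() = Q ^+ (p ^ t).
  rewrite eL derivD derivM derivX !(deriv_exprp charF) //; ring.
have Q0 : Q != 0.
  by apply: contraNneq dL0 => Q0; rewrite eL' Q0 expr0n gtn_eqF // ltnW.
set C := R + 'X^M * Q in eC.
have dC : C^`() = R^`() + 'X^M * Q^`() by rewrite /C derivD derivM dXM; ring.
have LC : L %| C by rewrite -eC -(prednK (ltnW tau1)) exprS -mulrA dvdp_mulr.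
have LC' : L %| C^`().
  have [m em] : exists m, tau = m.+2 by exists tau.-2; lia.
  rewrite -eC em !exprS -!mulrA derivM; apply: dvdp_add; last exact: dvdp_mulr.
  by apply/dvdp_mull/dvdp_mulr.
have W : Q * R^`() - R * Q^`() = 0.
  apply: (@deg_lt_dvdp _ L).
    have [dR /(_ Q0) dQ _] := deg_expr_addX R Q P1; rewrite -eL in dR dQ.
    have d1 : (2 * deg R <= p ^ t * deg R)%N by rewrite leq_mul2r P1 orbT.
    have d2 : (2 * deg Q <= p ^ t * deg Q)%N by rewrite leq_mul2r P1 orbT.
    apply: (@leq_ltn_trans (deg Q + deg R)); last by lia.
    have dR' := deg_deriv_le R; have dQ' := deg_deriv_le Q.
    by apply: deg_sub_le; [|rewrite addnC]; apply: deg_mul_le => //; lia.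
  have -> : Q * R^`() - R * Q^`() = Q * C^`() - C * Q^`() by rewrite dC /C; ring.
  by apply: dvdp_sub; [apply: dvdp_mull | apply: dvdp_mulr].
move/eqP: W; rewrite subr_eq0 => /eqP W.
(* A common divisor of Q and R divides both L and L' = Q^(p^t). Coprimality then turns Q R' = R Q'
   into Q %| Q', so that Q' = 0. *)
have cQR : coprimep Q R.
  apply/coprimepP => k kQ kR; move/coprimepP: sepL; apply.
    by rewrite eL; apply: dvdp_add; [|apply: dvdp_mull]; rewrite -(prednK (ltnW P1)) exprS dvdp_mulr.
  by rewrite eL' -(prednK (ltnW P1)) exprS dvdp_mulr.
have Q'0 : Q^`() = 0.
  apply: contra_eq (erefl true) => Q'0.
  have : Q %| Q^`() by rewrite -(Gauss_dvdpr _ cQR) -W dvdp_mulr.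
  by move/(deg_dvdp Q'0); rewrite leqNgt deg_deriv.
have R'0 : R^`() = 0.
  by move/eqP: W; rewrite Q'0 mulr0 mulf_eq0 (negPf Q0) => /eqP.
have [R1 eR1] := deriv0_exprp charF rtK R'0; have [Q1 eQ1] := deriv0_exprp charF rtK Q'0.
have eM : M = (p ^ (n - t.+1) * p)%N by rewrite /M -expnSr subnSK.
have eC1 : C = (R1 + 'X^(p ^ (n - t.+1)) * Q1) ^+ p.
  have := exprDp_poly charF 1 R1 ('X^(p ^ (n - t.+1)) * Q1); rewrite expn1 => ->.
  by rewrite exprMn -exprM -eM -eR1 -eQ1.
have C'0 : C^`() = 0 by rewrite dC R'0 Q'0 mulr0 addr0.
have Y0 : Y != 0.
  by apply: contraNneq g0 => Y0; rewrite eg Y0 expr0n (gtn_eqF (ltnW P1)) mulr0.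
(* The logarithmic derivative of L^tau Y^r is zero, and w is minus the inverse of r modulo p. *)
have logY : L * Y^`() = (w * tau)%:R * (Y * L^`()).
  have e1 : tau%:R * (L^`() * Y) + r%:R * (L * Y^`()) = 0.
    apply: (mulfI (mulf_neq0 (expf_neq0 tau.-1 L0) (expf_neq0 r.-1 Y0))).
    rewrite mulr0 -C'0 -eC derivM !deriv_exp -!(mulr_natl (_ * _)).
    have -> : L ^+ tau = L * L ^+ tau.-1 by rewrite -exprS prednK // ltnW.
    have -> : Y ^+ r = Y * Y ^+ r.-1 by rewrite -exprS prednK // ltnW.
    by ring.
  have e2 : (w * r)%:R = -1 :> {poly F} := natr_eqm1 wr.
  transitivity (w%:R * (tau%:R * (L^`() * Y) + r%:R * (L * Y^`())) - (w * r)%:R * (L * Y^`()) ).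
    by rewrite e1 e2; ring.
  by rewrite !natrM; ring.
have [Y1 eY] := log_deriv_split sepL logY; set s := (w * tau %% p)%N in eY.
have /dvdnP[tau' et'] : (p %| tau + s * r)%N.
  rewrite /dvdn -modnDmr modnMml modnDmr.
  have -> : (tau + w * tau * r = tau * (w * r).+1)%N by ring.
  by rewrite -modnMmr (eqP wr) muln0 mod0n.
exists (v + s * p ^ t)%N, tau', Y1, R1, Q1; split.
- by rewrite eg eY exprMn -!exprM -expnS mulrA -exprD.
- have -> : (p ^ t.+1 * tau' = p ^ t * (tau' * p))%N by rewrite expnS; ring.
  by rewrite -et' mulnDr -ev; ring.
- apply: (exprp_inj_poly charF (n := 1)); rewrite expn1 -eC1 -eC eY.
  by rewrite !exprMn -!exprM -et' [(r * p)%N]mulnC exprD mulrA.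
by rewrite {1}eL eR1 eQ1 -!exprM -expnS.
Qed.

(** At t = n, deg L < p^n makes R and Q constant, so L^tau Y^r = R + X Q has degree at most 1. *)
Lemma power_structure_last v tau : power_structure n v tau -> tau = 1%N.
Proof.
move=> [Y [R [Q [eg ev eC eL]]]].
have Pn : (1 < p ^ n)%N by apply: leq_trans p_gt1 _; rewrite -{1}(expn1 p) leq_exp2l.
have [dR dQ _] := deg_expr_addX R Q Pn; rewrite -eL in dR dQ.
have tau0 : (0 < tau)%N by move: ev; case: (tau) => //; rewrite muln0.
have [dl0 dl1] := andP degL.
have R0 : deg R = 0%N by move: dR; case: (deg R) => // m; rewrite mulnS; lia.
have Q0 : deg Q = 0%N.
  have [->|/dQ] := eqVneq Q 0; first by rewrite deg0.
  by case: (deg Q) => // m; rewrite mulnS; lia.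
have Y0 : Y != 0.
  by apply: contraNneq g0 => Y0; rewrite eg Y0 expr0n (gtn_eqF (ltnW Pn)) mulr0.
have : (deg (L ^+ tau * Y ^+ r) <= 1)%N.
  rewrite eC subnn expn0 expr1; apply: deg_add_le; first by rewrite R0.
  by rewrite -[1%N]addn0; apply: deg_mul_le; rewrite ?Q0 // -['X]mulr1 deg_mulX ?oner_neq0 // -polyC1 deg_polyC.
rewrite deg_mul ?expf_neq0 // !deg_expr.
by move: dl0 tau0; case: (deg L) => // l _; case: (tau) => // -[|m] //; rewrite mulnS mulSn; lia.
Qed.

Lemma power_structure_exists :
  exists t v, (0 < t <= n)%N /\ power_structure t v 1.
Proof.
have H k : (k < n)%N -> (exists t v, (0 < t <= n)%N /\ power_structure t v 1) \/
    exists v tau, power_structure k.+1 v tau.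
  elim: k => [|k IH] kn; first by right; apply: power_structure1.
  case: (IH (ltnW kn)) => [|[v [tau ps]]]; first by left.
  have tau0 : (0 < tau)%N.
    by case: ps => Y [R [Q [_ ev _ _]]]; move: ev; case: (tau) => //; rewrite muln0.
  have [tau1|tau1] := leqP tau 1.
    left; exists k.+1, v; split; first exact: (ltnW kn).
    by have -> : 1%N = tau by lia.
  by right; apply: power_structure_step ps.
have := H n.-1; rewrite prednK // => /(_ (leqnn n))[//|[v [tau ps]]].
by exists n, v; rewrite n_gt0 leqnn; move: (ps); rewrite (power_structure_last ps).
Qed.

End PowerStructure.

(** * Extraction of a power from g *)

Section PowerExtraction.
Variables (F : fieldType) (p : nat).
Hypothesis charF : p \in [pchar F].
Variable rt : F -> F.
Hypothesis rtK : forall x, rt x ^+ p = x.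
Implicit Types a b g L Y R Q : {poly F}.

Let pP : prime p. Proof. exact: pcharf_prime charF. Qed.
Let p_gt1 : (1 < p)%N. Proof. exact: prime_gt1. Qed.
Let p_gt0 : (0 < p)%N. Proof. exact: prime_gt0. Qed.

Lemma powerfree_split v Y : (0 < v)%N -> Y != 0 ->
  exists H Psi, Y = H ^+ v * Psi /\ forall d, irreducible_poly d -> ~~ (d ^+ v %| Psi).
Proof.
move=> v0; have [m] := ubnP (deg Y); elim: m Y => // m IH Y Ym Y0.
have [[d irr /dvdpP[Z eY]]|nd] := classic (exists2 d, irreducible_poly d & d ^+ v %| Y); last first.
  exists 1, Y; split=> [|d irr]; first by rewrite expr1n mul1r.
  by apply/negP => dv; apply: nd; exists d.
have d0 : (0 < deg d)%N by case: (irr); rewrite size_deg ?(irredp_neq0 irr).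
have Z0 : Z != 0 by apply: contraNneq Y0 => Z0; rewrite eY Z0 mul0r.
have [|//|H [Psi [eZ free]]] := IH Z.
  move: Ym; rewrite eY deg_mul ?expf_neq0 ?(deg_gt0_neq0 d0) // deg_expr.
  by have := muln_gt0 v (deg d); rewrite v0 d0; lia.
by exists (H * d), Psi; rewrite eY eZ exprMn; split=> //; ring.
Qed.

Variables (n r t v : nat) (g L Y R Q : {poly F}).
Hypothesis r_gt1 : (1 < r)%N.
Hypothesis tn : (0 < t <= n)%N.
Hypothesis sepL : coprimep L L^`().
Hypothesis degL : (0 < deg L < p ^ n)%N.
Hypothesis eg : g = L ^+ v * Y ^+ (p ^ t).
Hypothesis ev : (1 + v * r = p ^ t)%N.
Hypothesis eC : L * Y ^+ r = R + 'X^(p ^ (n - t)) * Q.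
Hypothesis eL : L = R ^+ (p ^ t) + 'X * Q ^+ (p ^ t).
Hypothesis Y0 : Y != 0.

Let P1 : (1 < p ^ t)%N.
Proof. by case/andP: tn => t0 _; apply: leq_trans p_gt1 _; rewrite -{1}(expn1 p) leq_exp2l. Qed.
Let PM : (p ^ t * p ^ (n - t) = p ^ n)%N.
Proof. by case/andP: tn => _ tn'; rewrite -expnD subnKC. Qed.
Let L0 : L != 0. Proof. by apply: deg_gt0_neq0; case/andP: degL. Qed.
Let v_gt0 : (0 < v)%N. Proof. by move: ev P1; case: (v) => //; rewrite mul0n => <-. Qed.

Let Q0 : Q != 0.
Proof.
apply: contraTneq sepL => Q0; rewrite eL Q0 expr0n (gtn_eqF (ltnW P1)) mulr0 addr0.
rewrite (deriv_exprp charF); last by case/andP: tn.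
have e : L = R ^+ (p ^ t) by rewrite eL Q0 expr0n (gtn_eqF (ltnW P1)) mulr0 addr0.
by rewrite coprimep0 -size_poly_eq1 -e size_deg //; case/andP: degL; case: (deg L).
Qed.

Lemma power_structure_deg :
  [/\ (p ^ t * deg R <= deg L)%N, (p ^ t * deg Q + 1 <= deg L)%N, (deg R < p ^ (n - t))%N &
      (deg L + r * deg Y = p ^ (n - t) + deg Q)%N].
Proof.
have [dR /(_ Q0) dQ _] := deg_expr_addX R Q P1; rewrite -eL in dR dQ.
have RM : (deg R < p ^ (n - t))%N.
  rewrite -(ltn_pmul2l (ltnW P1)) PM; apply: leq_ltn_trans dR _.
  by case/andP: degL.
split=> //; rewrite -deg_expr -deg_mul ?expf_neq0 // eC deg_add_mulXn //.
by rewrite ltn_addr.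
Qed.

(** The degree identity forces Q and R to be constant. Then R + X^(p^(n-t)) Q is a constant times a
    power of some X - b, and so are its divisors L and Y. *)
Lemma power_structure_large m : (p ^ (n - t) <= p ^ t)%N -> (m * r = (p ^ n).-1)%N ->
  (0 < deg Y)%N -> exists b : F, g %= ('X - b%:P) ^+ m.
Proof.
move=> MP em Yd; have [dR dQ RM dC] := power_structure_deg.
have rY : (2 <= r * deg Y)%N by rewrite -[2%N]muln1 leq_mul.
have dQ0 : deg Q = 0%N.
  case: (deg Q) dC dQ => // d; rewrite mulnS => dC dQ.
  have : (d <= p ^ t * d)%N by rewrite leq_pmull // ltnW.
  by lia.
have dL : (deg L < p ^ t)%N by rewrite dQ0 in dC; lia.
have dR0 : deg R = 0%N by case: (deg R) dR => // d; rewrite mulnS; lia.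
have [eR eQ] := (deg0_polyC dR0, deg0_polyC dQ0).
set R0 := R`_0 in eR; set q0 := Q`_0 in eQ.
have q00 : q0 != 0 by rewrite -polyC_eq0 -eQ.
have [b eb] : exists b : F, R0 = - (b ^+ (p ^ (n - t))) * q0.
  exists (iter (n - t) rt (- R0 / q0)).
  have itK k x : iter k rt x ^+ (p ^ k) = x.
    elim: k x => [|k IH] x; first by rewrite expn0 expr1.
    by rewrite iterSr expnSr exprM IH rtK.
  by rewrite itK mulNr divfK ?opprK.
have eC' : L * Y ^+ r = q0 *: ('X - b%:P) ^+ (p ^ (n - t)).
  rewrite eC eR eQ eb (exprBp_poly charF) -mul_polyC -polyC_exp polyCM polyCN.
  by ring.
have Xb0 : 'X - b%:P != 0 by rewrite polyXsubC_eq0.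
have LXb : L %| ('X - b%:P) ^+ (p ^ (n - t)).
  by rewrite -(dvdpZr _ _ q00) -eC' dvdp_mulr.
have degXb i : deg (('X - b%:P) ^+ i) = i by rewrite deg_expr {1}/deg size_XsubC muln1.
have eqp_deg a1 a2 : a1 %= a2 -> deg a1 = deg a2 by move/eqp_size; rewrite /deg => ->.
have XbY : Y ^+ r %| ('X - b%:P) ^+ (p ^ (n - t)) by rewrite -(dvdpZr _ _ q00) -eC' dvdp_mull.
have YXb : Y %| ('X - b%:P) ^+ (p ^ (n - t)).
  by apply: dvdp_trans XbY; rewrite -(prednK (ltnW r_gt1)) exprS dvdp_mulr.
have [i _ eLi] := dvdp_exp_XsubCP LXb; have [j _ eYj] := dvdp_exp_XsubCP YXb.
have := eqp_deg _ _ eLi; have := eqp_deg _ _ eYj; rewrite !degXb => dY dLi.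
have L1 : deg L = 1%N.
  have dX : deg ('X * (q0 ^+ (p ^ t))%:P) = 1%N.
    by rewrite deg_mulX ?polyC_eq0 ?expf_neq0 // deg_polyC.
  by rewrite eL eR eQ -!polyC_exp addrC deg_add_eq dX // deg_polyC.
(* Multiplying p^(n-t) = 1 + r j by p^t = 1 + v r gives p^n - 1 = (v + j p^t) r. *)
exists b; have -> : m = (v + j * p ^ t)%N.
  suff e : (m * r = (v + j * p ^ t) * r)%N.
    by apply/eqP; rewrite -(eqn_pmul2r (ltnW r_gt1)) e.
  rewrite em mulnDl.
  have eM : (p ^ (n - t) = 1 + r * j)%N by move: dC; rewrite L1 dQ0 dY addn0.
  suff -> : (p ^ n = (v * r + j * p ^ t * r).+1)%N by [].
  rewrite -PM eM mulnDr muln1 -{1}ev add1n addSn; congr (_ + _).+1.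
  by ring.
have eLb : L %= 'X - b%:P by apply: eqp_trans eLi _; rewrite -dLi L1 expr1 eqpxx.
rewrite eg exprD exprM; apply: eqp_trans (eqp_mulr _ (eqp_exp v eLb)) _.
by apply/eqp_mull/eqp_exp.
Qed.

Lemma power_structure_small : t = 1%N -> exists H, g %= H ^+ v.
Proof.
move=> t1; have rv : (r * v = p.-1)%N by move: ev; rewrite t1 expn1 mulnC => <-.
have [v1|v1] := leqP v 1.
  by exists g; have -> : v = 1%N by [lia]; rewrite expr1 eqpxx.
have [H [Psi [eY free]]] := powerfree_split v_gt0 Y0.
have [H0 Psi0] : H != 0 /\ Psi != 0.
  by move: Y0; rewrite eY mulf_eq0 expf_eq0 v_gt0 negb_or => /andP[].
have v2 : (2 * v <= p.-1)%N by rewrite -rv leq_mul2r r_gt1 orbT.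
have [dR dQ RM dC] := power_structure_deg; rewrite t1 expn1 subn1 in dR dQ RM dC.
have dY : (r * deg Y = p.-1 * deg H + r * deg Psi)%N.
  by rewrite eY deg_mul ?expf_neq0 // deg_expr mulnDr mulnA rv.
have ep : (p = p.-1.+1)%N by rewrite prednK.
(* By [dY], this and the bound for Q are the weight bounds for a = H R and b = H Q. *)
have hR : (p.-1 * deg R + r * deg Y <= (p ^ n.-1).-1)%N.
  have dQR : (p.-1 * deg R + deg Q + 1 <= deg L)%N.
    move: dR dQ; rewrite [in (p * deg R)%N]ep [in (p * deg Q)%N]ep !mulSn => dR dQ.
    have [h|h] := leqP (deg R) (deg Q); last by lia.
    have : (p.-1 * deg R <= p.-1 * deg Q)%N by rewrite leq_mul2l h orbT.
    by lia.
  by lia.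
have hQ : (p.-1 * deg Q + r * deg Y <= (p ^ n.-1).-1)%N.
  by move: dQ; rewrite [in (p * deg Q)%N]ep !mulSn; lia.
have [Psi_deg|Psi_deg] := posnP (deg Psi).
  exists (L * H ^+ p); rewrite eg eY t1 expn1 !exprMn -!exprM [(v * p)%N]mulnC.
  rewrite mulrA -[X in _ %= X]mulr1; apply: eqp_mull.
  rewrite (deg0_polyC Psi_deg) -polyC_exp polyC_eqp1 expf_neq0 //.
  by rewrite -polyC_eq0 -(deg0_polyC Psi_deg).
have wt X : (p.-1 * deg X + r * deg Y <= (p ^ n.-1).-1)%N -> weight_le p r Psi n.-1 (H * X).
  move=> hX HX0; have X0 : X != 0 by apply: contraNneq HX0 => ->; rewrite mulr0.
  by rewrite deg_mul // mulnDr; lia.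
have eHC : H * R + 'X^(p ^ n.-1) * (H * Q) = H * (L * Y ^+ r).
  by rewrite eC t1 subn1; ring.
have : H * R + 'X^(p ^ n.-1) * (H * Q) = 0.
  apply: (@twisted_fixpoint_eq0 F p charF rt rtK v r Psi rv v1 v2 Psi0 free Psi_deg n.-1
    (H * R) (H * Q) (wt R hR) (wt Q hQ)).
  (* Here Y^r = H^(p-1) Psi^r, and the factor H put into a and b completes H^(p-1) to H^p. *)
  rewrite eHC {1}eY {1}eL t1 expn1 !exprMn -exprM [(v * r)%N]mulnC rv.
  transitivity (Psi ^+ r * (H * H ^+ p.-1 * (R ^+ p + 'X * Q ^+ p))); first by ring.
  by rewrite -exprS prednK //; ring.
rewrite eHC => /eqP; rewrite !mulf_eq0 (negPf H0) (negPf L0) expf_eq0 (negPf Y0) andbF.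
by [].
Qed.

End PowerExtraction.

(** * The differential equation of g and Lagrange interpolation *)

Section ValueSetEquation.
Variables (F : finFieldType) (p n : nat).
Hypothesis charF : p \in [pchar F].
Hypothesis n_gt0 : (0 < n)%N.
Hypothesis hq : #|F| = (p ^ n)%N.
Implicit Types a b g h L : {poly F}.

Let pP : prime p. Proof. exact: pcharf_prime charF. Qed.
Let p_gt1 : (1 < p)%N. Proof. exact: prime_gt1. Qed.

Local Notation Xq := ('X^(p ^ n) - 'X : {poly F}).

Lemma roots_eq0 (A : {set F}) a : (deg a < #|A|)%N -> {in A, forall x, a.[x] = 0} -> a = 0.
Proof.
move=> ha Ha; apply/eqP/negPn/negP => a0.
have rA : all (root a) (enum A).
  by apply/allP => x; rewrite mem_enum => /Ha ax; apply/rootP.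
by have := max_poly_roots a0 rA (enum_uniq A); rewrite size_deg // ltnS -cardE leqNgt ha.
Qed.

Lemma XqE : Xq = \prod_(x : F) ('X - x%:P).
Proof. by rewrite -hq finField_genPoly. Qed.

Lemma horner_Xq x : Xq.[x] = 0.
Proof. by rewrite hornerD hornerN hornerXn hornerX -hq expf_card subrr. Qed.

Lemma deriv_Xq : Xq^`() = -1.
Proof. by rewrite derivB (deriv_exprp charF) // derivX sub0r. Qed.

Lemma deg_Xq : deg Xq = (p ^ n)%N.
Proof.
have dX : deg ('X^(p ^ n) : {poly F}) = (p ^ n)%N by rewrite /deg size_polyXn.
rewrite deg_add_eq dX // degN {1}/deg size_polyX.
exact: leq_ltn_trans n_gt0 (ltn_expl n p_gt1).
Qed.

Lemma Xq_neq0 : Xq != 0.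
Proof. by apply: deg_gt0_neq0; rewrite deg_Xq expn_gt0 prime_gt0. Qed.

Lemma dvdp_Xq a : (forall x, a.[x] = 0) -> Xq %| a.
Proof.
move=> H; rewrite XqE -big_enum /=; apply: uniq_roots_dvdp.
  by apply/allP => x _; apply/rootP.
by rewrite uniq_rootsE enum_uniq.
Qed.

Variables (g h : {poly F}) (v : nat) (a0 : F).
Hypothesis g_deg : (0 < deg g)%N.
Hypothesis h_deg : (1 < deg h)%N.
Hypothesis gh_deg : (deg h * deg g < p ^ n)%N.
Hypothesis gh_roots : forall x, g.[x] = 0 \/ h.[g.[x]] = 0.
Hypothesis h_deriv : v%:R * ('X * h^`()) = a0%:P - h.
Hypothesis a0_neq0 : a0 != 0.

Lemma horner0_h : h.[0] = a0.
Proof.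
have /(congr1 (fun a : {poly F} => a.[0])) := h_deriv.
rewrite /= hornerM hornerM hornerX mul0r mulr0 hornerD hornerN hornerC => /esym/eqP.
by rewrite subr_eq0 => /eqP.
Qed.

Lemma deg_comp : deg (h \Po g) = (deg h * deg g)%N.
Proof. by rewrite /deg size_comp_poly. Qed.

Let g0 : g != 0. Proof. exact: deg_gt0_neq0. Qed.

Let Z := [set x : F | g.[x] == 0].

Let Z_card : (#|Z| <= deg g)%N.
Proof.
rewrite leqNgt; apply/negP => /roots_eq0 H; case/eqP: g0; apply: H => x.
by rewrite inE => /eqP.
Qed.

(** Differentiating g h(g) = W (X^q - X) shows that v W + a0 g' vanishes wherever g does not. Its
    degree is below deg g, while deg h >= 2 and deg h deg g < q leave more than deg g such
    points. *)
Lemma value_set_ode : v%:R * (g * (h \Po g)) = - (a0%:P * Xq * g^`()).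
Proof.
have /dvdpP[W eW] : Xq %| g * (h \Po g).
  by apply: dvdp_Xq => x; rewrite hornerM horner_comp; case: (gh_roots x) => ->; rewrite ?mul0r ?mulr0.
have dW : v%:R * (W^`() * Xq - W) = g^`() * (v%:R * (h \Po g) + (a0%:P - (h \Po g))).
  have := congr1 deriv eW; rewrite !derivM deriv_Xq deriv_comp mulrN1 => <-.
  have /(congr1 (fun a => a \Po g)) := h_deriv.
  rewrite comp_polyM comp_polyM comp_polyB comp_polyX comp_polyC -polyC1 -polyCMn comp_polyC polyCMn polyC1.
  by move=> <-; ring.
suff e : v%:R * W + a0%:P * g^`() = 0.
  rewrite eW; transitivity ((v%:R * W + a0%:P * g^`()) * Xq - a0%:P * Xq * g^`()); first by ring.
  by rewrite e mul0r add0r.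
apply: (@roots_eq0 (~: Z)) => [|x]; last first.
  rewrite !inE => gx; case: (gh_roots x) => [/eqP gx0|hgx]; first by rewrite gx0 in gx.
  have := congr1 (fun a : {poly F} => a.[x]) dW.
  have vx : (v%:R : {poly F}).[x] = v%:R by rewrite hornerMn hornerC.
  rewrite /= !(hornerM, hornerD, hornerN, hornerC, vx) horner_comp hgx.
  have := horner_Xq x; rewrite hornerD hornerN => -> e.
  transitivity (- (v%:R * (W^`().[x] * 0 - W.[x])) + a0 * g^`().[x]); first by ring.
  by rewrite e; ring.
have dWd : (deg W <= (deg g).-1)%N.
  have [->|W0] := eqVneq W 0; first by rewrite deg0.
  have h0 : h \Po g != 0 by apply: deg_gt0_neq0; rewrite deg_comp muln_gt0 g_deg ltnW.
  have := congr1 (@deg F) eW; rewrite !deg_mul ?Xq_neq0 // deg_comp deg_Xq.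
  by move: gh_deg g_deg; lia.
apply: (@leq_ltn_trans (deg g).-1).
  apply: deg_add_le.
    by rewrite mulr_natl; apply: leq_trans (deg_natmul_le _ _) _.
  by rewrite -[_.-1]add0n; apply: deg_mul_le; rewrite ?deg_polyC //; apply: deg_deriv_le.
have := cardsC Z; rewrite hq => eZ.
have : (2 * deg g <= deg h * deg g)%N by rewrite leq_mul2r h_deg orbT.
by lia.
Qed.

(** With M = (X^q - X) / L, both h(g) and - a0 M L' have degree below q and agree on F_q: off [Z]
    they vanish, and on [Z] h(0) = a0 and M L' = -1. Inserting this into the equation for g' gives
    the last relation. *)
Lemma value_set_log_deriv : (exists x, g.[x] = 0) ->
  exists L : {poly F}, [/\ coprimep L L^`(), (0 < deg L <= deg g)%N,
    L * (h \Po g) = - (a0%:P * (Xq * L^`())) & L * g^`() = v%:R * (g * L^`())].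
Proof.
move=> [x0 gx0].
pose L := \prod_(x in Z) ('X - x%:P) : {poly F}.
pose M := \prod_(x in ~: Z) ('X - x%:P) : {poly F}.
have eLM : L * M = Xq.
  by rewrite XqE (bigID (mem Z)) /=; congr (_ * _); apply: eq_bigl => x; rewrite inE.
have dLM : L^`() * M + L * M^`() = -1 by rewrite -derivM eLM deriv_Xq.
have dL : deg L = #|Z| by rewrite /L /deg -big_enum /= size_prod_XsubC -cardE.
have dM : deg M = #|~: Z|.
  by rewrite /M /deg -big_enum /= size_prod_XsubC -cardE.
have rL x : x \in Z -> L.[x] = 0.
  by move=> xZ; rewrite horner_prod (bigD1 x) //= hornerXsubC subrr mul0r.
have rM x : x \notin Z -> M.[x] = 0.
  rewrite -in_setC => xZ.
  by rewrite horner_prod (bigD1 x) //= hornerXsubC subrr mul0r.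
have sepL : coprimep L L^`().
  apply/Bezout_coprimepP; exists (- M^`(), - M) => /=.
  have -> : - M^`() * L + - M * L^`() = 1 by rewrite -[1]opprK -dLM; ring.
  exact: eqpxx.
have eh : h \Po g = - (a0%:P * (M * L^`())).
  apply/eqP; rewrite -addr_eq0; apply/eqP; apply: (@roots_eq0 setT) => [|x _].
    rewrite cardsT hq; apply: (@leq_ltn_trans (p ^ n).-1); last by rewrite prednK // expn_gt0 prime_gt0.
    apply: deg_add_le; first by rewrite deg_comp; move: gh_deg; lia.
    rewrite -[_.-1]add0n; apply: deg_mul_le; first by rewrite deg_polyC.
    have := deg_deriv_le L; have := cardsC Z; rewrite hq -dL -dM => e dL'.
    have : (deg (M * L^`()) <= deg M + (deg L).-1)%N by apply: deg_mul_le.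
    suff : (0 < deg L)%N by lia.
    by rewrite dL card_gt0; apply/set0Pn; exists x0; rewrite inE gx0.
  rewrite hornerD horner_comp !hornerM hornerC.
  have [xZ|xZ] := boolP (x \in Z); last first.
    have gx : g.[x] != 0 by move: xZ; rewrite inE.
    case: (gh_roots x) => [/eqP gx0'|->]; first by rewrite gx0' in gx.
    by rewrite rM // mul0r mulr0 addr0.
  have : g.[x] = 0 by apply/eqP; move: xZ; rewrite inE.
  move=> ->; rewrite horner0_h.
  have := congr1 (fun a : {poly F} => a.[x]) dLM.
  rewrite /= hornerD !hornerM rL // mul0r addr0 hornerN hornerC => e.
  by rewrite mulrC -[M.[x] * _]mulrC e mulN1r subrr.
have L0 : L != 0 by apply: contraTneq sepL => ->; rewrite deriv0 coprimep0 -size_poly_eq1 size_poly0.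
have hL : L * (h \Po g) = - (a0%:P * (Xq * L^`())) by rewrite eh -eLM; ring.
exists L; split=> //.
  by rewrite dL Z_card card_gt0 andbT; apply/set0Pn; exists x0; rewrite inE gx0.
have a0P : a0%:P != 0 :> {poly F} by rewrite polyC_eq0.
apply: (mulfI (mulf_neq0 a0P Xq_neq0)).
transitivity (- (L * (v%:R * (g * (h \Po g))))); first by rewrite value_set_ode; ring.
transitivity (- (v%:R * g * (L * (h \Po g)))); first by ring.
by rewrite hL; ring.
Qed.

End ValueSetEquation.

Lemma finField_pth_root (F : finFieldType) (p n : nat) :
  (0 < n)%N -> #|F| = (p ^ n)%N -> forall x : F, (x ^+ (p ^ n.-1)) ^+ p = x.
Proof. by move=> n0 hq x; rewrite -exprM -expnSr prednK // -hq expf_card. Qed.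

Lemma eqp_expr_dvd (F : fieldType) (g H : {poly F}) w v :
  (w %| v)%N -> g %= H ^+ v -> exists H', g %= H' ^+ w.
Proof. by case/dvdnP=> d -> h; exists (H ^+ d); rewrite -exprM. Qed.

(** * Polynomials whose nonzero values are r-th roots of unity *)

Section SubgroupValues.
Variables (F : finFieldType) (p : nat).
Hypothesis charF : p \in [pchar F].
Hypothesis hq : #|F| = (p ^ 4)%N.
Variables (e r w : nat) (g : {poly F}).
Hypothesis e_gt0 : (0 < e)%N.
Hypothesis r_gt1 : (1 < r)%N.
Hypothesis wr : (w * r = (p ^ e).-1)%N.
Hypothesis e_dvd : ((p ^ e).-1 %| (p ^ 4).-1)%N.
Hypothesis e_min : forall t, (0 < t)%N -> (r %| (p ^ t).-1)%N -> ((p ^ e).-1 %| (p ^ t).-1)%N.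
Hypothesis g_deg : (0 < deg g)%N.
Hypothesis rg_deg : (r * deg g < p ^ 4)%N.
Hypothesis g_values : forall x, g.[x] = 0 \/ g.[x] ^+ r = 1.
Hypothesis g_root : exists x, g.[x] = 0.

Let pP : prime p. Proof. exact: pcharf_prime charF. Qed.
Let p_gt1 : (1 < p)%N. Proof. exact: prime_gt1. Qed.
Let p_gt0 : (0 < p)%N. Proof. exact: prime_gt0. Qed.

Theorem subgroup_values_power : exists H : {poly F}, g %= H ^+ w.
Proof.
have rtK := finField_pth_root (isT : (0 < 4)%N) hq.
have wr1 : (p %| (w * r).+1)%N by rewrite wr prednK ?expn_gt0 ?p_gt0 // dvdn_exp.
have g0 : g != 0 := deg_gt0_neq0 g_deg.
pose h : {poly F} := 'X^r - 1.
have dh : deg h = r.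
  have dX : deg ('X^r : {poly F}) = r by rewrite /deg size_polyXn.
  by rewrite deg_add_eq dX // degN -polyC1 deg_polyC; lia.
have hg : h \Po g = g ^+ r - 1 by rewrite comp_polyB comp_Xn_poly -polyC1 comp_polyC.
have h_roots x : g.[x] = 0 \/ h.[g.[x]] = 0.
  case: (g_values x); [by left|move=> gr; right].
  by rewrite -horner_comp hg hornerD hornerN hornerC horner_exp gr subrr.
(* Both sides are - X^r, because w r = -1 modulo p. *)
have dh' : w%:R * ('X * h^`()) = (-1)%:P - h.
  rewrite derivB -polyC1 derivC subr0 derivXn -[_ *+ r]mulr_natl ['X * _]mulrCA -exprS (ltn_predK r_gt1).
  by rewrite mulrA -natrM (natr_eqm1 charF wr1) /h polyCN polyC1; ring.
have h1 : (1 < deg h)%N by rewrite dh.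
have hgd : (deg h * deg g < p ^ 4)%N by rewrite dh.
have m10 : (-1 : F) != 0 by rewrite oppr_eq0 oner_eq0.
have [L [sepL /andP[L0 Lg] eqL logL]] :=
  value_set_log_deriv charF (isT : (0 < 4)%N) hq g_deg h1 hgd h_roots dh' m10 g_root.
have eqL' : L * g ^+ r = L + ('X^(p ^ 4) - 'X) * L^`().
  by move: eqL; rewrite hg polyCN polyC1 => eqL; rewrite -[L * _](subrK L) -{2}[L]mulr1 -mulrBr eqL; ring.
have degL : (0 < deg L < p ^ 4)%N.
  rewrite L0 /=; apply: leq_ltn_trans Lg _; apply: leq_ltn_trans rg_deg.
  by rewrite leq_pmull // ltnW.
have [t [v [tn [Y [R [Q [eg ev eC eL]]]]]]] :=
  power_structure_exists charF rtK (isT : (0 < 4)%N) r_gt1 wr1 g0 sepL degL logL eqL'.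
rewrite muln1 in ev; rewrite expr1 in eC.
have [t0 t4] := andP tn.
have P0 : (0 < p ^ t)%N by rewrite expn_gt0 p_gt0.
have Y0 : Y != 0 by apply: contraNneq g0 => Y0; rewrite eg Y0 expr0n (gtn_eqF P0) mulr0.
have evr : (v * r = (p ^ t).-1)%N by rewrite -ev.
(* Since r divides v r = p^t - 1, so does p^e - 1 = w r by [e_min]. *)
have wv : (w %| v)%N.
  by have := e_min t0; rewrite -evr dvdn_mull // -wr dvdn_pmul2r ?(ltnW r_gt1) //; apply.
have [t1|t1] := eqVneq t 1%N.
  have [H gH] := power_structure_small charF rtK r_gt1 tn sepL degL eg ev eC eL Y0 t1.
  exact: eqp_expr_dvd wv gH.
have [Yd|Yd] := posnP (deg Y).
  apply: (eqp_expr_dvd wv (H := L)); rewrite eg -[X in _ %= X]mulr1; apply: eqp_mull.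
  rewrite (deg0_polyC Yd) -polyC_exp polyC_eqp1 expf_neq0 //.
  by rewrite -polyC_eq0 -(deg0_polyC Yd).
have /dvdnP[c ec] := e_dvd.
have em : (c * w * r = (p ^ 4).-1)%N by rewrite -mulnA wr -ec.
(* The exponent 4 enters here: t >= 2 gives 4 - t <= t. *)
have MP : (p ^ (4 - t) <= p ^ t)%N by rewrite leq_exp2l //; move: t t0 t4 t1 {tn Y R Q eg ev eC eL P0 Y0 evr wv Yd} => [|[|[|[|[|]]]]].
have [b gb] := power_structure_large charF rtK r_gt1 tn sepL degL eg ev eC eL Y0 MP em Yd.
by apply: eqp_expr_dvd gb; rewrite dvdn_mull.
Qed.

End SubgroupValues.

(** * Numerical constraints on l = deg L, y = deg Y, d = deg Q and c = deg R *)

Lemma dim3_degrees p w l y d : prime p -> (0 < w < p)%N -> (0 < l)%N -> (p * d + 1 <= l)%N ->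
  (p ^ 2 * l + w * (p ^ 2 + p + 1) * y = p ^ 3 + d)%N -> y = 0%N.
Proof.
move=> pP /andP[w0 wp] l0 dl e; have p1 := prime_gt1 pP.
have sp : (p < p ^ 2)%N by rewrite -{1}(expn1 p) ltn_exp2l.
(* Otherwise the surplus p^2 (l - p) on the left exceeds d, since p d < l. *)
have lp : (l <= p)%N.
  rewrite leqNgt; apply/negP => pl.
  have [c el] : exists c, l = (p.+1 + c)%N by exists (l - p.+1)%N; rewrite subnKC.
  have : (d <= p * d)%N by rewrite leq_pmull // ltnW.
  have : (c <= p ^ 2 * c)%N by rewrite leq_pmull // expn_gt0 prime_gt0.
  move: e dl sp; rewrite el mulnDr mulnS -expnSr.
  move: (p ^ 3)%N (p ^ 2)%N (p * d)%N (p ^ 2 * c)%N (w * _ * y)%N => *; lia.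
have d0 : d = 0%N by case: d dl {e} => // d; rewrite mulnS => h; move: (p * d)%N h => z; lia.
(* With d = 0, the cofactor w (p^2 + p + 1) of y is prime to p. A positive y would then contribute
   at least p^4. *)
have py : (p ^ 2 %| y)%N.
  have : (p ^ 2 %| w * (p ^ 2 + p + 1) * y)%N.
    have : (p ^ 2 %| p ^ 2 * l + w * (p ^ 2 + p + 1) * y)%N.
      by rewrite e d0 addn0 dvdn_exp2l.
    by rewrite dvdn_addr // dvdn_mulr.
  rewrite Gauss_dvdr // coprimeXl // coprimeMr; apply/andP; split.
    by rewrite prime_coprime // gtnNdvd.
  rewrite prime_coprime // dvdn_addr ?dvdn1 ?neq_ltn ?p1 ?orbT //.
  by rewrite dvdn_add // dvdn_exp.
have [//|y0] := posnP y.
have h1 : (p ^ 2 * p ^ 2 <= w * (p ^ 2 + p + 1) * y)%N.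
  apply: leq_mul (dvdn_leq y0 py); apply: leq_trans (leq_pmull _ w0).
  by rewrite -addnA leq_addr.
have h2 : (p ^ 3 < p ^ 2 * p ^ 2)%N by rewrite -expnD ltn_exp2l.
have h3 : (0 < p ^ 2 * l)%N by rewrite muln_gt0 expn_gt0 l0 prime_gt0.
move: e h1 h2 h3; rewrite d0.
move: (p ^ 3)%N (p ^ 2 * l)%N (p ^ 2 * p ^ 2)%N (w * _ * y)%N => *; lia.
Qed.

(** Room for splitting the equation of dimension 2 at X^(p^3). *)
Lemma dim2_degree_bounds p w l y d c : (1 < p)%N -> (0 < w)%N ->
  (p * c <= l)%N -> (p * d + 1 <= l)%N ->
  (p * l + w * p.+1 * y = p ^ 3 + d)%N ->
  (c + y < p ^ 3)%N /\ (p * d + w.+1 * y < p ^ 3)%N.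
Proof.
move=> p1 w0 cl dl e.
have yw : (y <= w * y)%N by rewrite leq_pmull.
have e3 : (p ^ 3 = p * p * p)%N by rewrite !expnS expn0; ring.
have h1 : (p * (p * d + 1) <= p * l)%N by rewrite leq_mul2l dl orbT.
have h2 : (p * (p * c) <= p * l)%N by rewrite leq_mul2l cl orbT.
rewrite mulSn; move: e h1 h2; rewrite e3.
have -> : (w * p.+1 * y = p.+1 * (w * y))%N by ring.
move: (w * y)%N yw (p * l)%N {cl dl} => z yz P; case: p p1 {e3} => [|[|u]] // _.
move=> e h1 h2; have h : (u.+1 * d + z <= u.+2 * u.+1)%N by nia.
have dp : (d <= u.+2)%N by nia.
have zp : (z <= u.+2 * u.+1)%N by nia.
have cp : (c <= u.+2 + d)%N by clear h zp; nia.
have big : (u.+2 * u.+2 * u.+2 = u.+2 * u.+1 * u.+2 + u.+2 * u.+2)%N by ring.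
split; first by rewrite big; nia.
have d2 : (u.+2 * d <= 2 * (u.+1 * d))%N by rewrite mulnA leq_mul2r; apply/orP; right; lia.
by rewrite big; nia.
Qed.

(** The bound on p d + w y comes from a Wronskian. For y > 0 it forces d = 0 and w y < p, whereas
    the equation modulo p gives p %| w y. *)
Lemma dim2_degrees p w l y d c : prime p -> (0 < w < p)%N -> (0 < l)%N ->
  (p * d + w * y <= c)%N -> (p * c <= l)%N ->
  (p * l + w * p.+1 * y = p ^ 3 + d)%N -> y = 0%N.
Proof.
move=> pP /andP[w0 wp] l0 dc cl e; have p1 := prime_gt1 pP.
have yw : (y <= w * y)%N by rewrite leq_pmull.
have h : (p * (p * (p * d + w * y)) <= p * l)%N.
  by rewrite leq_mul2l; apply/orP; right; apply: leq_trans cl; rewrite leq_mul2l dc orbT.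
have e3 : (p ^ 3 = p * p * p)%N by rewrite !expnS expn0; ring.
have [//|y0] := posnP y.
have wy0 : (0 < w * y)%N by rewrite muln_gt0 w0 y0.
have d0 : d = 0%N.
  move: e h; rewrite e3 (_ : (w * p.+1 * y = p.+1 * (w * y))%N); last by ring.
  by move: (w * y)%N wy0 (p * l)%N => z z0 P; case: d {dc} => // d; nia.
have wyp : (w * y < p)%N.
  move: e h; rewrite e3 d0 (_ : (w * p.+1 * y = p.+1 * (w * y))%N); last by ring.
  by move: (w * y)%N (p * l)%N => z P; nia.
have : (p %| w * y)%N.
  have : (p %| p * l + w * p.+1 * y)%N by rewrite e d0 addn0 dvdn_exp.
  rewrite dvdn_addr; last exact: dvdn_mulr.
  by rewrite mulnAC mulnS dvdn_addl // dvdn_mull.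
by move/(dvdn_leq wy0); rewrite leqNgt wyp.
Qed.

(** * Values in a subspace: Y is constant *)

Section SubspaceValues.
Variables (F : fieldType) (p : nat).
Hypothesis charF : p \in [pchar F].
Variable rt : F -> F.
Hypothesis rtK : forall x, rt x ^+ p = x.

Let pP : prime p. Proof. exact: pcharf_prime charF. Qed.
Let p_gt1 : (1 < p)%N. Proof. exact: prime_gt1. Qed.
Let p_gt0 : (0 < p)%N. Proof. exact: prime_gt0. Qed.

Variables (n v w : nat) (g L b : {poly F}) (a0 : F).
Hypothesis n_gt0 : (0 < n)%N.
Hypothesis wv : (w * v = p.-1)%N.
Hypothesis g0 : g != 0.
Hypothesis a0_neq0 : a0 != 0.
Hypothesis b_neq0 : b \Po g != 0.
Hypothesis sepL : coprimep L L^`().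
Hypothesis degL : (0 < deg L < p ^ n)%N.
Hypothesis logL : L * g^`() = v%:R * (g * L^`()).
Hypothesis eqL : L * (a0%:P + g ^+ w * (b \Po g) ^+ p) = - (a0%:P * (('X^(p ^ n) - 'X) * L^`())).

Let w_gt0 : (0 < w)%N. Proof. by move: wv; case: (w) => //; rewrite mul0n; lia. Qed.
Let v_gt0 : (0 < v)%N. Proof. by move: wv; case: (v) => //; rewrite muln0; lia. Qed.
Let v_lt_p : (v < p)%N. Proof. by move: wv w_gt0; case: (w) => // u; rewrite mulSn; lia. Qed.
Let w_lt_p : (w < p)%N. Proof. by move: wv v_gt0; case: (v) => // u; rewrite mulnS; lia. Qed.
Let L0 : L != 0. Proof. by apply: deg_gt0_neq0; case/andP: degL. Qed.
Let a0P : a0%:P != 0 :> {poly F}. Proof. by rewrite polyC_eq0. Qed.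

(* R + X^(q/p) Q is the p-th root of L + (X^q - X) L'. *)
Lemma subspace_structure : exists Y R Q k,
  [/\ g = L ^+ v * Y ^+ p, L = R ^+ p + 'X * Q ^+ p, L^`() = Q ^+ p, k != 0 &
    R + 'X^(p ^ n.-1) * Q = k%:P * (L * Y ^+ w * (b \Po g))].
Proof.
have [Y eg] := log_deriv_split charF rtK sepL logL; rewrite modn_small // in eg.
pose k := rt (- a0^-1).
have kp : k ^+ p = - a0^-1 by rewrite rtK.
have eC : L + ('X^(p ^ n) - 'X) * L^`() = (k%:P * (L * Y ^+ w * (b \Po g))) ^+ p.
  apply: (mulfI a0P); rewrite exprMn -polyC_exp kp mulrA -polyCM mulrN divff // polyCN polyC1.
  have -> : (L * Y ^+ w * (b \Po g)) ^+ p = L * (g ^+ w * (b \Po g) ^+ p).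
    rewrite !exprMn eg !exprMn -!exprM [(v * w)%N]mulnC wv [(p * w)%N]mulnC.
    by rewrite -[in L ^+ p](prednK p_gt0) exprS; ring.
  transitivity (a0%:P * L - L * (a0%:P + g ^+ w * (b \Po g) ^+ p)); last by ring.
  by rewrite eqL; ring.
have d0 : (L + ('X^(p ^ n) - 'X) * L^`())^`() = 0.
  by rewrite eC (deriv_dvdp_expr charF _ (dvdnn p)).
have [R [Q [eL eL' eRQ]]] := frobenius_split charF rtK n_gt0 d0.
exists Y, R, Q, k; split=> //.
  apply: contraTneq a0_neq0 => k0; move: kp; rewrite k0 expr0n (gtn_eqF p_gt0) => /esym/eqP.
  by rewrite oppr_eq0 invr_eq0 => ->.
by apply: (exprp_inj_poly charF (n := 1)); rewrite expn1 -eRQ eC.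
Qed.

Lemma subspace_structure_deg Y R Q k : g = L ^+ v * Y ^+ p -> L = R ^+ p + 'X * Q ^+ p ->
  L^`() = Q ^+ p -> k != 0 -> R + 'X^(p ^ n.-1) * Q = k%:P * (L * Y ^+ w * (b \Po g)) ->
  [/\ Y != 0, Q != 0, (p * deg R <= deg L)%N, (p * deg Q + 1 <= deg L)%N &
      (deg L + w * deg Y + deg b * (v * deg L + p * deg Y) = p ^ n.-1 + deg Q)%N].
Proof.
move=> eg eL eL' k0 eC.
have Y0 : Y != 0 by apply: contraNneq g0 => Y0; rewrite eg Y0 expr0n (gtn_eqF p_gt0) mulr0.
have [l0 l1] := andP degL.
have Q0 : Q != 0.
  apply: contraTneq sepL => Q0; rewrite eL' Q0 expr0n (gtn_eqF p_gt0).
  by rewrite coprimep0 -size_poly_eq1 size_deg // eqSS -lt0n l0.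
have [dR /(_ Q0) dQ _] := deg_expr_addX R Q p_gt1; rewrite -eL in dR dQ.
split=> //.
have dg : deg g = (v * deg L + p * deg Y)%N by rewrite eg deg_mul ?expf_neq0 // !deg_expr.
have dbg : deg (b \Po g) = (deg b * deg g)%N by rewrite /deg size_comp_poly.
have : deg (R + 'X^(p ^ n.-1) * Q) = (p ^ n.-1 + deg Q)%N.
  apply: deg_add_mulXn => //; apply: ltn_addr.
  by rewrite -(ltn_pmul2l p_gt0) -expnS prednK //; apply: leq_ltn_trans dR l1.
rewrite eC deg_mul ?polyC_eq0 ?mulf_neq0 ?expf_neq0 // deg_polyC add0n.
by rewrite !deg_mul ?mulf_neq0 ?expf_neq0 // deg_expr dbg dg.
Qed.

(** Degrees suffice here: with w v = p - 1 the coefficient of deg L becomes 1 + (p - 1)(p + 1) =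
    p^2. *)
Lemma subspace_values_dim3 : n = 4 -> deg b = (w * p.+1)%N -> g %= L ^+ v.
Proof.
move=> n4 db; have [Y [R [Q [k [eg eL eL' k0 eC]]]]] := subspace_structure.
have [Y0 Q0 dR dQ] := subspace_structure_deg eg eL eL' k0 eC.
rewrite n4 /= db => dC.
have {}dC : (p ^ 2 * deg L + w * (p ^ 2 + p + 1) * deg Y = p ^ 3 + deg Q)%N.
  rewrite -dC; have -> : (w * p.+1 * (v * deg L + p * deg Y) = 
    p.-1 * p.+1 * deg L + w * p.+1 * p * deg Y)%N by rewrite -wv; ring.
  have -> : (p ^ 2 * deg L = deg L + p.-1 * p.+1 * deg L)%N.
    by rewrite -mulSn; congr (_ * _)%N; move: p_gt1; case: (p) => // u _; rewrite /= !expnS expn0; ring.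
  by rewrite !expnS expn0; ring.
have Yd : deg Y = 0%N.
  by apply: dim3_degrees pP _ _ dQ dC; rewrite ?w_gt0 //; case/andP: degL.
rewrite eg (deg0_polyC Yd) -[X in _ %= X]mulr1; apply: eqp_mull.
by rewrite -polyC_exp polyC_eqp1 expf_neq0 // -polyC_eq0 -(deg0_polyC Yd).
Qed.

(** The degree identity alone admits y > 0. A second relation comes from differentiating R + X^(p^3)
    Q = k L Y^w b(g) and splitting the result at X^(p^3). *)
Lemma subspace_values_dim2 (b0 c : F) : n = 4 -> b = b0%:P + c *: 'X^w -> b0 != 0 -> c != 0 ->
  g %= L ^+ v.
Proof.
move=> n4 eb b00 c0; have [Y [R [Q [k [eg eL eL' k0 eC]]]]] := subspace_structure.
have [Y0 Q0 dR dQ] := subspace_structure_deg eg eL eL' k0 eC.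
have db : deg b = w.
  have dX : deg (c *: 'X^w) = w by rewrite deg_scale // /deg size_polyXn.
  by rewrite eb addrC deg_add_eq dX // deg_polyC.
rewrite n4 /= db in eC * => dC.
have {}dC : (p * deg L + w * p.+1 * deg Y = p ^ 3 + deg Q)%N.
  rewrite -dC mulnDr mulnA wv -[in (p * deg L)%N](prednK p_gt0) mulSn; ring.
have [bd1 bd2] := dim2_degree_bounds p_gt1 w_gt0 dR dQ dC.
set B := b \Po g in eC.
have eB : B = b0%:P + c%:P * g ^+ w.
  by rewrite /B eb comp_polyD comp_polyC comp_polyZ comp_Xn_poly mul_polyC.
have wv1 : (w * v)%:R = -1 :> {poly F}.
  by apply: (natr_eqm1 charF); rewrite wv prednK.
(* By this identity the terms in L' B cancel when k L Y^w B is differentiated, and only b0 L' is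
   left. *)
have LB' : L * B^`() = (b0%:P - B) * L^`().
  rewrite eB derivD derivM !derivC deriv_exp -[_ *+ w]mulr_natl.
  have -> : g ^+ w = g * g ^+ w.-1 by rewrite -exprS prednK.
  transitivity (c%:P * w%:R * g ^+ w.-1 * (L * g^`())); first by ring.
  rewrite logL; transitivity (c%:P * (w * v)%:R * g ^+ w.-1 * g * L^`()).
    by rewrite natrM; ring.
  by rewrite wv1; ring.
have dX3 : ('X^(p ^ 3) : {poly F})^`() = 0 by rewrite (deriv_exprp charF).
have eC' : Y * (R^`() + 'X^(p ^ 3) * Q^`()) =
    k%:P * b0%:P * Q ^+ p * Y ^+ w.+1 + w%:R * Y^`() * (R + 'X^(p ^ 3) * Q).
  have -> : R^`() + 'X^(p ^ 3) * Q^`() = (R + 'X^(p ^ 3) * Q)^`().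
    by rewrite derivD derivM dX3; ring.
  rewrite eC deriv_mulC !derivM deriv_exp -[_ *+ w]mulr_natl -eL'.
  have -> : Y ^+ w.+1 = Y * Y * Y ^+ w.-1 by rewrite -mulrA -!exprS prednK.
  have -> : Y ^+ w = Y * Y ^+ w.-1 by rewrite -exprS prednK.
  transitivity (k%:P * Y * ((L^`() * (Y * Y ^+ w.-1) + L * (w%:R * (Y^`() * Y ^+ w.-1))) * B
    + Y * Y ^+ w.-1 * (L * B^`()))); first by ring.
  by rewrite LB'; ring.
have degw a : (deg (w%:R * a : {poly F}) <= deg a)%N by rewrite mulr_natl deg_natmul_le.
have [e1 e2] : Y * R^`() - w%:R * (Y^`() * R) - k%:P * b0%:P * Q ^+ p * Y ^+ w.+1 = 0 /\
    Y * Q^`() - w%:R * (Y^`() * Q) = 0.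
  apply: (@add_mulXn_eq0 _ _ _ (p ^ 3)).
    rewrite -ltnS -(prednK (n := p ^ 3)) ?expn_gt0 ?p_gt0 // !ltnS.
    have dR' := deg_deriv_le R; have dY' := deg_deriv_le Y.
    apply: deg_sub_le; last first.
      rewrite -polyCM -mulrA -[_.-1]add0n; apply: deg_mul_le; first by rewrite deg_polyC.
      by rewrite deg_mul ?expf_neq0 // !deg_expr; move: bd2; case: (p ^ 3)%N.
    apply: (@leq_trans (deg R + deg Y)); last by move: bd1; case: (p ^ 3)%N.
    apply: deg_sub_le; first by rewrite addnC; apply: deg_mul_le => //; apply: leq_trans dR' (leq_pred _).
    apply: leq_trans (degw _) _; rewrite addnC; apply: deg_mul_le => //.
    exact: leq_trans dY' (leq_pred _).
  transitivity (Y * (R^`() + 'X^(p ^ 3) * Q^`()) - w%:R * Y^`() * (R + 'X^(p ^ 3) * Q)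
     - k%:P * b0%:P * Q ^+ p * Y ^+ w.+1); first by ring.
  by rewrite eC'; ring.
(* Eliminating Y' between the two halves gives the Wronskian; b0 != 0 makes it nonzero, so its
   degree bounds deg R from below. *)
have W : Q * R^`() - R * Q^`() = k%:P * b0%:P * Q ^+ p.+1 * Y ^+ w.
  apply: (mulfI Y0); rewrite !exprS.
  transitivity (Q * (Y * R^`() - w%:R * (Y^`() * R) - k%:P * b0%:P * Q ^+ p * Y ^+ w.+1)
    - R * (Y * Q^`() - w%:R * (Y^`() * Q)) + k%:P * b0%:P * Q * Q ^+ p * Y ^+ w.+1); first by ring.
  by rewrite e1 e2 exprS; ring.
have dW : (p.+1 * deg Q + w * deg Y <= deg R + deg Q)%N.
  have -> : (p.+1 * deg Q + w * deg Y = deg (Q * R^`() - R * Q^`()))%N.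
    have kb : (k * b0)%:P != 0 :> {poly F} by rewrite polyC_eq0 mulf_neq0.
    rewrite W -polyCM !deg_mul ?mulf_neq0 ?expf_neq0 //.
    by rewrite deg_polyC !deg_expr add0n.
  have dR' := deg_deriv_le R; have dQ' := deg_deriv_le Q.
  apply: deg_sub_le; first by rewrite addnC; apply: deg_mul_le => //; apply: leq_trans dR' (leq_pred _).
  by apply: deg_mul_le => //; apply: leq_trans dQ' (leq_pred _).
have Yd : deg Y = 0%N.
  apply: dim2_degrees pP _ _ _ dR dC; rewrite ?w_gt0 //; first by case/andP: degL.
  by move: dW; rewrite mulSn -addnA [(deg R + _)%N]addnC leq_add2l.
rewrite eg (deg0_polyC Yd) -[X in _ %= X]mulr1; apply: eqp_mull.
by rewrite -polyC_exp polyC_eqp1 expf_neq0 // -polyC_eq0 -(deg0_polyC Yd).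
Qed.

End SubspaceValues.

(** * Counting values, roots of unity and fibres of power maps *)

Section ValueSets.
Variable F : finFieldType.
Implicit Types (f g : {poly F}) (S : {set F}).

Lemma value_setP f y : reflect (exists x, y = f.[x]) (y \in value_set f).
Proof. by apply: (iffP imsetP) => [[x _ ->]|[x ->]]; exists x. Qed.

Lemma value_set_exp f w : value_set (f ^+ w) = set_exp (value_set f) w.
Proof.
apply/setP => y; apply/idP/imsetP => [/value_setP[x ->]|[z /value_setP[x ->] ->]].
  by exists f.[x]; [apply/value_setP; exists x|rewrite horner_exp].
by apply/value_setP; exists x; rewrite horner_exp.
Qed.

Lemma card_fibre_le f y : (0 < deg f)%N -> (#|[set x | f.[x] == y]| <= deg f)%N.
Proof.
move=> f0; have d : deg (f - y%:P) = deg f by rewrite deg_add_eq // degN deg_polyC.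
rewrite leqNgt; apply/negP => lt.
have e : f - y%:P = 0.
  apply: (@roots_eq0 _ [set x | f.[x] == y]); first by rewrite d.
  by move=> x; rewrite inE => /eqP fx; rewrite hornerD hornerN hornerC fx subrr.
by move: d f0; rewrite e deg0 => <-.
Qed.

Lemma card_value_set_ge f : (0 < deg f)%N -> (#|F| <= deg f * #|value_set f|)%N.
Proof.
move=> f0; rewrite -cardsT -sum1_card (partition_big (fun x => f.[x]) (mem (value_set f))) /=.
  rewrite mulnC -sum_nat_const; apply: leq_sum => y _.
  rewrite sum1dep_card; apply: leq_trans (card_fibre_le y f0).
  by apply: subset_leq_card; apply/subsetP => x; rewrite !inE.
by move=> x _; apply/value_setP; exists x.
Qed.

Lemma mvspE g r : mvsp g -> #|value_set g| = r.+1 ->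
  [/\ (0 < deg g)%N, ((#|F| - 1) %/ deg g = r)%N & (r * deg g < #|F|)%N].
Proof.
move=> [s1 c] er; have g0 : g != 0 by rewrite -size_poly_gt0 ltnW.
have d0 : (0 < deg g)%N by move: s1; rewrite size_deg.
have e : ((#|F| - 1) %/ deg g = r)%N by move: c; rewrite er addn1 => -[].
split=> //; have q0 : (0 < #|F|)%N by apply/card_gt0P; exists 0.
by rewrite -(ltn_predK q0) ltnS -subn1 -e leq_trunc_div.
Qed.

(** Nested floors: (q - 1) %/ (w deg f) is (q - 1) %/ deg f = w r divided by w. *)
Lemma mvsp_exp S f w r : (0 < w)%N -> #|S| = (w * r).+1 -> #|set_exp S w| = r.+1 ->
  mvsp_on S f -> mvsp_on (set_exp S w) (f ^+ w).
Proof.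
move=> w0 cS cSw [mf vf]; have [d0 e _] := mvspE mf (etrans (congr1 (fun A : {set F} => #|A|) vf) cS).
split; last by rewrite value_set_exp vf.
have dw : deg (f ^+ w) = (w * deg f)%N by rewrite deg_expr.
split; last by rewrite value_set_exp vf cSw -[(size _).-1]/(deg _) dw mulnC divnMA e mulKn // addn1.
have : (0 < deg (f ^+ w))%N by rewrite dw muln_gt0 w0.
by rewrite size_deg // expf_neq0 // deg_gt0_neq0.
Qed.

(* The values of f cannot be fewer than (q - 1) / deg f + 1, which already exhausts S. *)
Lemma mvsp_of_exp S f w r : (0 < w)%N -> mvsp (f ^+ w) -> #|value_set (f ^+ w)| = r.+1 ->
  value_set f \subset S -> (#|S| <= (w * r).+1)%N -> mvsp_on S f.
Proof.
move=> w0 mg cg sub cS; have [d0 e _] := mvspE mg cg.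
have dw : deg (f ^+ w) = (w * deg f)%N by rewrite deg_expr.
rewrite dw muln_gt0 w0 /= in d0; rewrite dw mulnC divnMA in e.
have le1 : (w * r <= (#|F| - 1) %/ deg f)%N by rewrite -e mulnC leq_trunc_div.
have lt1 : ((#|F| - 1) %/ deg f < #|value_set f|)%N.
  rewrite -(ltn_pmul2l d0); apply: leq_trans (card_value_set_ge d0).
  have q0 : (0 < #|F|)%N by apply/card_gt0P; exists 0.
  apply: (@leq_ltn_trans (#|F| - 1)); first by rewrite mulnC leq_trunc_div.
  by rewrite subn1 prednK.
have le2 := subset_leq_card sub.
have vS : value_set f = S.
  by apply/eqP; rewrite eqEcard sub; lia.
split=> //; split; first by rewrite size_deg ?deg_gt0_neq0.
by rewrite -[(size f).-1]/(deg f) addn1; lia.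
Qed.

(** Evaluation at x shows that the constant is H(x)^(-w), itself a w-th power. *)
Lemma eqp_expr_eq g (H : {poly F}) w x : (0 < w)%N -> g %= H ^+ w -> g.[x] = 1 ->
  exists f, g = f ^+ w.
Proof.
move=> w0 /eqpP[[c1 c2] /= /andP[c10 c20] e] gx.
have := congr1 (fun a : {poly F} => a.[x]) e; rewrite /= !hornerZ horner_exp gx mulr1 => ec.
have Hx : H.[x] != 0.
  by apply: contraNneq c10 => Hx; rewrite ec Hx expr0n (gtn_eqF w0) mulr0.
exists (H.[x]^-1 *: H); rewrite exprZn exprVn.
apply: (canRL (scalerK (expf_neq0 w Hx))); apply: (scalerI c20).
by rewrite -e scalerA -ec.
Qed.

Lemma expr_gcdn_eq1 (x : F) a b : (0 < a)%N -> x ^+ a = 1 -> x ^+ b = 1 -> x ^+ gcdn a b = 1.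
Proof.
move=> a0 xa xb; have [c _ /dvdnP[d ed]] := Bezoutl b a0.
have := congr1 (fun i => x ^+ i) ed.
by rewrite /= exprD [(c * b)%N]mulnC [(d * a)%N]mulnC !exprM xa xb !expr1n mulr1.
Qed.

Lemma card_unity_le r : (0 < r)%N -> (#|[set x : F | (x ^+ r == 1)%R]| <= r)%N.
Proof.
move=> r0; have dX : deg ('X^r : {poly F}) = r by rewrite /deg size_polyXn.
have := @card_fibre_le 'X^r 1; rewrite dX => /(_ r0) h; apply: leq_trans h.
by apply: subset_leq_card; apply/subsetP => x; rewrite !inE hornerXn.
Qed.

(** All of A consists of gcd(r, N)-th roots of unity, of which there are at most gcd(r, N). *)
Lemma unity_dvd (A : {set F}) r N : (0 < r)%N -> (r <= #|A|)%N ->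
  (forall x, x \in A -> x ^+ r = 1 /\ x ^+ N = 1) -> (r %| N)%N.
Proof.
move=> r0 rA HA; have g0 : (0 < gcdn r N)%N by rewrite gcdn_gt0 r0.
have : (r <= gcdn r N)%N.
  apply: leq_trans rA (leq_trans _ (card_unity_le g0)).
  apply: subset_leq_card; apply/subsetP => x /HA[xr xN].
  by rewrite inE expr_gcdn_eq1.
by move=> le; apply/gcdn_idPl/eqP; rewrite eqn_leq le dvdn_leq // dvdn_gcdl.
Qed.

Lemma card_unity v : (v %| #|F|.-1)%N -> #|[set x : F | x ^+ v == 1]| = v.
Proof.
case/dvdnP=> c ec.
have q1 : (0 < #|F|.-1)%N by rewrite -ltnS (ltn_predK (finRing_gt1 F)) finRing_gt1.
have v0 : (0 < v)%N by move: q1; rewrite ec; case: (v) => //; rewrite muln0.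
apply/eqP; rewrite eqn_leq card_unity_le //.
have dX i : deg ('X^i : {poly F}) = i by rewrite /deg size_polyXn.
have d1 i : (0 < i)%N -> deg ('X^i - 1 : {poly F}) = i.
  by move=> i0; rewrite deg_add_eq dX // degN -polyC1 deg_polyC.
have [G eG] : exists G : {poly F}, 'X^(#|F|.-1) - 1 = ('X^v - 1) * G.
  by exists (\sum_(i < c) ('X^v) ^+ i); rewrite -subrX1 -exprM mulnC -ec.
have P0 : ('X^(#|F|.-1) - 1 : {poly F}) != 0 by apply: deg_gt0_neq0; rewrite d1.
have [V0 G0] : ('X^v - 1 : {poly F}) != 0 /\ G != 0.
  by move: P0; rewrite eG mulf_eq0 negb_or => /andP[].
have dG : #|F|.-1 = (v + deg G)%N by rewrite -(d1 _ q1) eG deg_mul // d1.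
set A := [set x : F | x ^+ v == 1]; rewrite leqNgt; apply/negP => Av.
case/eqP: G0; apply: (@roots_eq0 _ ((~: A) :\ 0)) => [|x].
  have e1 : (#|A| + #|~: A| = #|F|)%N := cardsC A.
  have := cardsD1 (0 : F) (~: A).
  have -> : (0 : F) \in ~: A by rewrite !inE expr0n (gtn_eqF v0) eq_sym oner_eq0.
  move: e1 dG Av q1; move: #|F| #|A| #|~: A| #|_ :\ 0| => c1 c2 c3 c4; lia.
rewrite !inE => /andP[x0 xv].
have := congr1 (fun a : {poly F} => a.[x]) eG.
rewrite /= hornerM !(hornerD, hornerN, hornerXn) -polyC1 hornerC.
have -> : x ^+ #|F|.-1 = 1.
  apply: (mulfI x0); rewrite mulr1 -exprS (ltn_predK (finRing_gt1 F)) expf_card //.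
rewrite subrr => /esym/eqP; rewrite mulf_eq0 subr_eq0 (negPf xv) /=.
by move/eqP.
Qed.

(** The fibre of u -> u^v over a nonzero value is a coset of the v roots of unity, and it stays
    inside S by the closure hypothesis. *)
Lemma card_set_exp S v : (v %| #|F|.-1)%N -> 0 \in S ->
  (forall u y, u \in S -> y ^+ v = u ^+ v -> y \in S) ->
  exists2 r, #|set_exp S v| = r.+1 & #|S| = (v * r).+1.
Proof.
move=> vq S0 clS; have [c ec] := dvdnP vq.
have q1 : (0 < #|F|.-1)%N by rewrite -ltnS (ltn_predK (finRing_gt1 F)) finRing_gt1.
have v0 : (0 < v)%N by move: q1; rewrite ec; case: (v) => //; rewrite muln0.
have zS : 0 \in set_exp S v by apply/imsetP; exists 0; rewrite ?expr0n ?(gtn_eqF v0).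
exists #|set_exp S v :\ 0|; first by rewrite (cardsD1 0) zS.
rewrite (cardsD1 0 S) S0 add1n; congr _.+1.
rewrite -sum1_card (partition_big (fun u => u ^+ v) (mem (set_exp S v :\ 0))) /=; last first.
  move=> u; rewrite !inE => /andP[u0 uS]; rewrite expf_neq0 //=.
  by apply/imsetP; exists u.
rewrite mulnC -sum_nat_const; apply: eq_bigr => s; rewrite inE => /andP[].
rewrite inE => s0 /imsetP[u uS es]; rewrite sum1dep_card.
have u0 : u != 0 by apply: contraNneq s0 => u0; rewrite es u0 expr0n (gtn_eqF v0).
rewrite -[RHS](card_unity vq) -[RHS](card_imset _ (mulIf u0)); apply: eq_card => y.
rewrite [LHS]inE; apply/idP/imsetP => [|[z]].
  rewrite !inE => /andP[/andP[y0 yS] /eqP yv].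
  by exists (y / u); rewrite ?divfK // inE exprMn exprVn yv es divff // expf_neq0.
rewrite inE => /eqP zv ->; rewrite !inE exprMn zv mul1r es eqxx andbT.
have zu : z * u \in S by apply: (clS u) => //; rewrite exprMn zv mul1r.
rewrite zu andbT mulf_neq0 //.
by apply: contra_eq_neq zv => ->; rewrite expr0n (gtn_eqF v0) eq_sym oner_eq0.
Qed.

(** Multiplication by x permutes A; compare the products of all elements. *)
Lemma card_mul_closed_expr (A : {set F}) x : (forall y z, y \in A -> z \in A -> y * z \in A) ->
  0 \notin A -> x \in A -> x ^+ #|A| = 1.
Proof.
move=> clA A0 xA; have n0 y : y \in A -> y != 0 by move=> yA; apply: contraNneq A0 => <-.
have im : [set x * y | y in A] = A.
  apply/eqP; rewrite eqEcard card_imset ?leqnn ?andbT; last exact: mulfI (n0 x xA).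
  by apply/subsetP => _ /imsetP[y yA ->]; apply: clA.
have P0 : \prod_(y in A) y != 0 by apply/prodf_neq0 => y; apply: n0.
apply: (mulIf P0); rewrite mul1r -[in RHS]im big_imset /=; last first.
  by move=> y z _ _; apply: mulfI (n0 x xA) _ _.
by rewrite big_split /= prodr_const.
Qed.

Lemma subfield_expr (A : {set F}) x : (forall y z, y \in A -> z \in A -> y * z \in A) ->
  0 \in A -> x \in A -> x ^+ #|A| = x.
Proof.
move=> clA A0 xA; have [->|x0] := eqVneq x 0.
  by rewrite expr0n gtn_eqF //; apply/card_gt0P; exists 0.
rewrite (cardsD1 0) A0 exprS (@card_mul_closed_expr (A :\ 0)) ?mulr1 //.
- by move=> y z; rewrite !inE => /andP[y0 yA] /andP[z0 zA]; rewrite mulf_neq0 // clA.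
- by rewrite !inE eqxx.
by rewrite !inE x0.
Qed.

Lemma mem_subfield_expr (A : {set F}) x : (1 < #|A|)%N ->
  (forall y, y \in A -> y ^+ #|A| = y) -> x ^+ #|A| = x -> x \in A.
Proof.
move=> A1 HA xA; have dX : deg ('X^#|A| : {poly F}) = #|A| by rewrite /deg size_polyXn.
have d : deg ('X^#|A| - 'X : {poly F}) = #|A| by rewrite deg_add_eq dX // degN /deg size_polyX.
apply/negPn/negP => nx.
have e : 'X^#|A| - 'X = 0 :> {poly F}.
  apply: (@roots_eq0 _ (x |: A)); first by rewrite d cardsU1 nx.
  move=> y; rewrite inE hornerD hornerN hornerXn hornerX => /orP[|/HA->]; last by rewrite subrr.
  by rewrite inE => /eqP->; rewrite xA subrr.
by move: d; rewrite e deg0 => h; rewrite -h in A1.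
Qed.

End ValueSets.

(** * Subspaces and subfields over the prime field *)

Section PrimeSubspaces.
Variables (F : finFieldType) (p : nat).
Hypothesis charF : p \in [pchar F].
Local Notation L := (pPrimeCharType charF).
Implicit Types (U : {vspace L}) (E : {subfield L}).

Let pP : prime p. Proof. exact: pcharf_prime charF. Qed.

Lemma set_of_vspaceE U (x : F) : (x \in set_of_vspace U) = ((x : L) \in U).
Proof. by rewrite inE. Qed.

Lemma card_set_of_vspace U : #|set_of_vspace U| = (p ^ \dim U)%N.
Proof.
have := card_vspace U; rewrite [X in (X ^ _)%N](card_Fp pP) => <-.
by apply: eq_card => x; rewrite set_of_vspaceE.
Qed.

Lemma dim_fullv_prime n : #|F| = (p ^ n)%N -> \dim {:L} = n.
Proof.
move=> hq; apply/eqP; rewrite -(eqn_exp2l _ _ (prime_gt1 pP)) -hq -card_set_of_vspace -cardsT.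
by apply/eqP; apply: eq_card => x; rewrite set_of_vspaceE memvf inE.
Qed.

Lemma subfield_set E : let A := set_of_vspace E in
  [/\ 0 \in A, forall x y, x \in A -> y \in A -> x * y \in A,
     forall x, x \in A -> x ^+ (p ^ \dim E) = x & forall x, x ^+ (p ^ \dim E) = x -> x \in A].
Proof.
move=> A; have A0 : 0 \in A by rewrite set_of_vspaceE mem0v.
have AM x y : x \in A -> y \in A -> x * y \in A.
  by rewrite !set_of_vspaceE => xE yE; apply: (@memvM _ L E).
have cA := card_set_of_vspace E; rewrite -/A in cA.
have AX x : x \in A -> x ^+ (p ^ \dim E) = x by rewrite -cA; apply: subfield_expr.
split=> // x; rewrite -cA; apply: mem_subfield_expr.
  by rewrite cA -(expn0 p) ltn_exp2l ?prime_gt1 // adim_gt0.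
by move=> y yA; rewrite cA AX.
Qed.

Lemma exprDp_char t (x y : F) : (x + y) ^+ (p ^ t) = x ^+ (p ^ t) + y ^+ (p ^ t).
Proof. by apply: exprDn_pchar; rewrite pnatX pnatE // charF. Qed.

Lemma scaler_exprp t (c : 'F_p) (x : L) : (c *: x) ^+ (p ^ t) = c *: x ^+ (p ^ t).
Proof.
rewrite exprZn; congr (_ *: _).
have cp : c ^+ p = c by rewrite -[RHS]expf_card; congr (_ ^+ _); rewrite card_Fp.
by elim: t => [|t IH]; rewrite ?expn0 // expnS exprM cp.
Qed.

(** The fixed points are closed under linear combinations, so passing to the span adds nothing.
    These subfields are what the generated subfield is compared with. *)
Lemma frobenius_fixed_aspace t : exists E : {subfield L}, forall x : L, (x \in E) = (x ^+ (p ^ t) == x).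
Proof.
pose X := enum [set x : F | x ^+ (p ^ t) == x] : seq L.
pose V := <<X>>%VS.
have memV (x : L) : (x \in V) = (x ^+ (p ^ t) == x).
  apply/idP/idP => [/(coord_span (X := in_tuple X))-> |xt]; last first.
    by apply: memv_span; rewrite mem_enum inE.
  apply/eqP; apply: (big_ind (fun y : L => y ^+ (p ^ t) = y)).
  - by rewrite expr0n expn_eq0 (gtn_eqF (prime_gt0 pP)).
  - by move=> y z ey ez; rewrite (exprDp_char t (y : F) z) ey ez.
  move=> i _; rewrite scaler_exprp; congr (_ *: _).
  have : X`_i \in X by rewrite mem_nth.
  by rewrite mem_enum inE => /eqP.
have aV : is_aspace V.
  apply/andP; split.
    by apply: has_algid1; rewrite memV expr1n.
  by apply/prodvP => x y; rewrite !memV exprMn => /eqP-> /eqP->.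
by exists (ASpace aV).
Qed.

End PrimeSubspaces.

Lemma dvdn_pred_expn p k c : (k %| c)%N -> ((p ^ k).-1 %| (p ^ c).-1)%N.
Proof. by case/dvdnP=> d ->; rewrite mulnC expnM [in X in (_ %| X)%N]predn_exp dvdn_mulr. Qed.

Lemma small_dims k d : (0 < k)%N -> (k %| d)%N -> (0 < d)%N -> (d <= 3)%N -> d <> k ->
  k = 1%N /\ (d = 2 \/ d = 3)%N.
Proof.
move=> k0 kd d0; have := dvdn_leq d0 kd.
by case: d kd d0 => [|[|[|[|d]]]] //; case: k k0 => [|[|[|[|k]]]] //; auto.
Qed.

(** * The value sets U^v in a field with p^4 elements *)

Section Subspaces.
Variables (F : finFieldType) (p : nat).
Hypothesis charF : p \in [pchar F].
Hypothesis hq : #|F| = (p ^ 4)%N.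
Local Notation L := (pPrimeCharType charF).
Implicit Types (U : {vspace L}) (K E : {subfield L}).

Let pP : prime p. Proof. exact: pcharf_prime charF. Qed.
Let p_gt1 : (1 < p)%N. Proof. exact: prime_gt1. Qed.

(** For u != 0 the quotient y / u is a v-th root of unity, and K contains all of these. *)
Lemma exp_closed_vspace K U v : (0 < v)%N -> (v %| (p ^ \dim K).-1)%N -> (K * U <= U)%VS ->
  forall u y, u \in set_of_vspace U -> y ^+ v = u ^+ v -> y \in set_of_vspace U.
Proof.
move=> v0 vK KU u y uU yu; have [u0|u0] := eqVneq u 0.
  by move: yu; rewrite u0 expr0n (gtn_eqF v0) => /eqP; rewrite expf_eq0 v0 => /eqP->; rewrite -u0.
have zK : y / u \in set_of_vspace K.
  have [_ _ _] := subfield_set K; apply.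
  have z1 : (y / u) ^+ v = 1 by rewrite exprMn exprVn yu divff // expf_neq0.
  have P0 : (0 < p ^ \dim K)%N by rewrite expn_gt0 prime_gt0.
  case/dvdnP: vK => c ec; rewrite -(prednK P0) ec exprS mulnC exprM z1 expr1n mulr1.
  by [].
move: zK uU; rewrite !set_of_vspaceE => zK uU.
by have := subvP KU _ (memv_mul zK uU); rewrite [_ * _](divfK u0 y).
Qed.

Lemma dim_dvd4 E : (\dim E %| 4)%N.
Proof.
rewrite -(dim_fullv_prime charF hq); apply: field_module_dimS.
exact: subvf.
Qed.

Lemma pred_dim_dvd E : ((p ^ \dim E).-1 %| #|F|.-1)%N.
Proof. by rewrite hq dvdn_pred_expn // dim_dvd4. Qed.

Theorem mvsp_on_subfield_exp (U : {subfield L}) v : (0 < v)%N -> (v %| (p ^ \dim U).-1)%N ->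
  (2 < #|set_exp (set_of_vspace U) v|)%N ->
  let S := set_exp (set_of_vspace U) v in
  let E := subfield_gen charF S in
  forall g : {poly F}, mvsp_on S g <->
    exists f : {poly F}, mvsp_on (set_of_vspace E) f /\
      g = f ^+ (((p ^ \dim E).-1 * v) %/ (p ^ \dim U).-1)%N.
Proof.
move=> v0 vU S2 S E.
have [A0 AM AX AX'] := subfield_set U; have [B0 BM BX BX'] := subfield_set E.
have Upos : (0 < p ^ \dim U)%N by rewrite expn_gt0 prime_gt0.
have Epos : (0 < p ^ \dim E)%N by rewrite expn_gt0 prime_gt0.
have vq : (v %| #|F|.-1)%N := dvdn_trans vU (pred_dim_dvd U).
have UU : (U * U <= U)%VS by apply/prodvP => x y; apply: memvM.
have [r cS] := card_set_exp vq A0 (exp_closed_vspace v0 vU UU).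
rewrite -/S in cS; rewrite card_set_of_vspace => cA; have vr : (v * r = (p ^ \dim U).-1)%N by rewrite cA.
have r2 : (1 < r)%N by rewrite -ltnS -cS.
have r0 : (0 < r)%N := ltnW r2.
pose mu := [set x : F | x ^+ r == 1].
(* S has r + 1 elements, and there are at most r roots of unity to fill it. *)
have eS : S = 0 |: mu.
  have sub : S \subset 0 |: mu.
    apply/subsetP => s /imsetP[u uA ->]; rewrite !inE expf_eq0 v0 /=.
    have [//|u0] := eqVneq u 0; rewrite -exprM vr; apply/eqP/(mulfI u0).
    by rewrite -exprS prednK // mulr1 AX.
  apply/eqP; rewrite eqEcard sub cS cardsU1 /=.
  by apply: leq_trans (leq_add (leq_b1 _) (card_unity_le F r0)) _.
have SB s : s \in S -> s \in set_of_vspace E.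
  by move=> sS; rewrite set_of_vspaceE; apply: seqv_sub_adjoin; rewrite mem_enum.
have muS (x : F) : x ^+ r = 1 -> x \in S by move=> xr; rewrite eS !inE xr eqxx orbT.
have x0r (x : F) : x ^+ r = 1 -> x != 0.
  by move=> xr; apply: contra_eq_neq xr => ->; rewrite expr0n (gtn_eqF r0) eq_sym oner_eq0.
have BX1 (x : F) : x != 0 -> x \in set_of_vspace E -> x ^+ (p ^ \dim E).-1 = 1.
  by move=> x0 xB; apply: (mulfI x0); rewrite -exprS prednK // mulr1 BX.
have cmu : (r <= #|mu|)%N.
  by move: cS; rewrite eS cardsU1 inE expr0n (gtn_eqF r0) eq_sym oner_eq0 add1n => -[->].
have rE : (r %| (p ^ \dim E).-1)%N.
  apply: (unity_dvd r0 cmu) => x; rewrite inE => /eqP xr; split=> //.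
  by apply: BX1 (x0r _ xr) (SB _ (muS _ xr)).
have [w ew] := dvdnP rE.
have Epred : (0 < (p ^ \dim E).-1)%N.
  by rewrite -ltnS prednK // -(expn0 p) ltn_exp2l // adim_gt0.
have w0 : (0 < w)%N by move: Epred; rewrite ew; case: (w).
(* The numerator is w r v and the denominator is v r. *)
have -> : (((p ^ \dim E).-1 * v) %/ (p ^ \dim U).-1)%N = w.
  by rewrite ew -vr -mulnA [(r * v)%N]mulnC mulnK // muln_gt0 v0.
have wE : (w %| (p ^ \dim E).-1)%N by rewrite ew dvdn_mulr.
have EE : (E * E <= E)%VS by apply/prodvP => x y; apply: memvM.
have cB : #|set_of_vspace E| = (w * r).+1 by rewrite card_set_of_vspace -ew prednK.
have eBS : set_exp (set_of_vspace E) w = S.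
  have [r' cBw] := card_set_exp (dvdn_trans wE (pred_dim_dvd E)) B0 (exp_closed_vspace w0 wE EE).
  rewrite cB => -[/eqP]; rewrite eqn_pmul2l // => /eqP er'.
  apply/eqP; rewrite eqEcard cS cBw er' leqnn andbT.
  apply/subsetP => s /imsetP[u uB ->]; have [->|u0] := eqVneq u 0.
    by rewrite expr0n (gtn_eqF w0) eS !inE eqxx.
  by apply: muS; rewrite -exprM -ew BX1.
move=> g; split=> [[mg vg]|[f [mf ->]]]; last first.
  have cBw : #|set_exp (set_of_vspace E) w| = r.+1 by rewrite eBS cS.
  by have := mvsp_exp w0 cB cBw mf; rewrite eBS.
have cg : #|value_set g| = r.+1 by rewrite vg.
have [g_deg _] := mvspE mg cg; rewrite hq => rg.
have gS x : g.[x] \in S by rewrite -vg; apply/value_setP; exists x.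
have gval x : g.[x] = 0 \/ g.[x] ^+ r = 1.
  by have := gS x; rewrite eS !inE => /orP[/eqP|/eqP]; [left|right].
have [x0 gx0] : exists x, g.[x] = 0.
  by have : 0 \in S by [rewrite eS !inE eqxx]; rewrite -vg => /value_setP[x ->]; exists x.
have [x1 gx1] : exists x, g.[x] = 1.
  have : 1 \in S by apply: muS; rewrite expr1n.
  by rewrite -vg => /value_setP[x ->]; exists x.
(* If r divides p^t - 1, the fixed field of the p^t-th power map contains S, hence E. *)
have e_min t : (0 < t)%N -> (r %| (p ^ t).-1)%N -> ((p ^ \dim E).-1 %| (p ^ t).-1)%N.
  move=> t0 /dvdnP[c ec]; have Pt : (0 < p ^ t)%N by rewrite expn_gt0 prime_gt0.
  have [X memX] := frobenius_fixed_aspace charF t.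
  have EX : (E <= X)%VS.
    apply/Fadjoin_seqP; split; first exact: sub1v.
    move=> s; rewrite mem_enum memX eS !inE => /orP[/eqP->|/eqP sr].
      by rewrite expr0n (gtn_eqF Pt).
    by rewrite -(prednK Pt) exprS ec mulnC exprM sr expr1n mulr1.
  apply: (@unity_dvd F (set_of_vspace E :\ 0)) => // [|x].
    have := cardsD1 0 (set_of_vspace E); rewrite B0 cB add1n => -[<-].
    by rewrite -ew.
  rewrite in_setD1 => /andP[xn0 xE]; split; first exact: BX1.
  move: xE; rewrite set_of_vspaceE => /(subvP EX); rewrite memX => /eqP xt.
  by apply: (mulfI xn0); rewrite -exprS prednK // mulr1.
have e_dvd : ((p ^ \dim E).-1 %| (p ^ 4).-1)%N by rewrite -hq pred_dim_dvd.
have [H gH] := subgroup_values_power charF hq (adim_gt0 E) r2 (esym ew) e_dvd e_min g_deg rg gval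
  (ex_intro _ x0 gx0).
have [f ef] := eqp_expr_eq w0 gH gx1.
exists f; split=> //; rewrite ef in mg cg.
apply: (mvsp_of_exp w0 mg cg); last by rewrite cB.
apply/subsetP => y /value_setP[x ->].
have := gval x; rewrite ef horner_exp => -[/eqP|].
  by rewrite expf_eq0 w0 => /eqP->.
by rewrite -exprM -ew => fx; apply: BX'; rewrite -(prednK Epos) exprS fx mulr1.
Qed.

(** A matrix with one more row than columns has a nonzero left kernel vector. Its entries give a
    linearized polynomial vanishing on a basis of U, hence on U. *)
Lemma linearized_annihilator U : exists a : nat -> F,
  (exists2 i, (i <= \dim U)%N & a i != 0) /\
  forall u, u \in set_of_vspace U -> \sum_(i < (\dim U).+1) a i * u ^+ (p ^ i) = 0.
Proof.
pose A : 'M[F]_((\dim U).+1, \dim U) := \matrix_(i, j) (((vbasis U)`_j : F) ^+ (p ^ i)).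
have : kermx A != 0.
  by rewrite kermx_eq0 /row_free ltn_eqF // ltnS rank_leq_col.
case/rowV0Pn=> c /sub_kermxP cA c0.
exists (fun i => c 0 (inord i)); split.
  case/rV0Pn: c0 => i ci; exists i; first by rewrite -ltnS.
  by rewrite inord_val.
move=> u; rewrite set_of_vspaceE => /coord_vbasis ->.
pose phi (x : L) : L := \sum_(i < (\dim U).+1) (c 0 (inord i) : L) * x ^+ (p ^ i).
rewrite -/(phi _); apply: (big_ind (fun x => phi x = 0)).
- rewrite /phi big1 // => i _.
  by rewrite expr0n expn_eq0 (gtn_eqF (prime_gt0 pP)) mulr0.
- move=> x y ex ey; rewrite -[RHS]addr0 -{1}ex -ey /phi -big_split /=.
  by apply: eq_bigr => i _; rewrite -mulrDr; congr (_ * _); apply: (exprDp_char charF).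
move=> j _; transitivity (coord (vbasis U) j u *: phi (vbasis U)`_j).
  by rewrite /phi scaler_sumr; apply: eq_bigr => i _; rewrite scaler_exprp scalerAr.
suff -> : phi (vbasis U)`_j = 0 by rewrite scaler0.
have := congr1 (fun M : 'rV[F]_(\dim U) => M 0 j) cA; rewrite !mxE => e; rewrite -[RHS]e.
by apply: eq_bigr => i _; rewrite mxE inord_val.
Qed.

Lemma linearized_eq0 (A : {set F}) (a : nat -> F) m : (p ^ m < #|A|)%N ->
  (forall u, u \in A -> \sum_(i < m.+1) a i * u ^+ (p ^ i) = 0) ->
  forall i, (i <= m)%N -> a i = 0.
Proof.
move=> mA HA i im; pose P : {poly F} := \sum_(i < m.+1) a i *: 'X^(p ^ i).
have P0 : P = 0.
  apply: (@roots_eq0 _ A) => [|u /HA e].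
    apply: leq_ltn_trans mA; apply: (big_ind (fun Q : {poly F} => deg Q <= p ^ m)%N).
    - by rewrite deg0.
    - by move=> Q1 Q2; apply: deg_add_le.
    move=> j _; rewrite -mul_polyC -[(p ^ m)%N]add0n; apply: deg_mul_le; first by rewrite deg_polyC.
    by rewrite /deg size_polyXn leq_exp2l // -ltnS.
  rewrite -[RHS]e horner_sum; apply: eq_bigr => j _.
  by rewrite hornerZ hornerXn.
have := congr1 (fun Q : {poly F} => Q`_(p ^ i)) P0.
rewrite coef0 coef_sum (bigD1 (Ordinal (im : (i < m.+1)%N))) //= coefZ coefXn eqxx mulr1.
rewrite big1 ?addr0 // => j ji; rewrite coefZ coefXn eqn_exp2l //.
by case: eqP => [e|_]; rewrite ?mulr0 //; case/eqP: ji; apply: val_inj.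
Qed.

Let rt (x : F) := x ^+ (p ^ 3).
Let rtK x : rt x ^+ p = x. Proof. exact: (finField_pth_root (isT : (0 < 4)%N) hq). Qed.

Lemma exprp_sum (n : nat) (f : 'I_n -> F) : (\sum_i f i) ^+ p = \sum_i f i ^+ p.
Proof.
by rewrite -(pFrobenius_autE charF) rmorph_sum.
Qed.

(** If [a 0] vanished, the p-th root of the polynomial would annihilate U with degree below #U; if
    the top coefficient vanished, the polynomial itself would. *)
Lemma linearized_separable U : exists a : nat -> F, [/\ a 0%N != 0, a (\dim U) != 0 &
  forall u, u \in set_of_vspace U -> \sum_(i < (\dim U).+1) a i * u ^+ (p ^ i) = 0].
Proof.
have [a [[i iU ai] Ha]] := linearized_annihilator U; exists a.
have cU := card_set_of_vspace U.
move: iU Ha cU; case: (\dim U) => [|d] id Ha cU.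
  by move: id ai; rewrite leqn0 => /eqP->; split.
have dU : (p ^ d < #|set_of_vspace U|)%N by rewrite cU ltn_exp2l.
split=> //; apply: contra_neq ai => a0.
  have [i0|i0] := posnP i; first by rewrite i0.
  have H : forall j, (j <= d)%N -> rt (a j.+1) = 0.
    apply: (linearized_eq0 (A := set_of_vspace U) dU) => u uU.
    have e : (\sum_(i < d.+1) rt (a i.+1) * u ^+ (p ^ i)) ^+ p = 0.
      rewrite exprp_sum -[RHS](Ha u uU) [RHS]big_ord_recl /= a0 mul0r add0r.
      by apply: eq_bigr => j _; rewrite exprMn rtK -exprM -expnSr.
    by move/eqP: e; rewrite expf_eq0 prime_gt0 // => /eqP.
  have := H i.-1; rewrite prednK // => /(_ ltac:(by rewrite -ltnS prednK)) ri.
  by rewrite -(rtK (a i)) ri expr0n (gtn_eqF (prime_gt0 pP)).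
have H : forall j, (j <= d)%N -> a j = 0.
  apply: (linearized_eq0 (A := set_of_vspace U) dU) => u /Ha.
  by rewrite big_ord_recr /= a0 mul0r addr0.
by move: id; rewrite leq_eqVlt ltnS => /orP[/eqP->|/H].
Qed.

Section SubspaceExponent.
Variables (U : {vspace L}) (v w r : nat) (a : nat -> F) (g b : {poly F}).
Hypothesis wv : (w * v = p.-1)%N.
Hypothesis a0 : a 0%N != 0.
Hypothesis aU : forall u, u \in set_of_vspace U -> \sum_(i < (\dim U).+1) a i * u ^+ (p ^ i) = 0.
Hypothesis bE : forall u : F, u * b.[u ^+ v] = \sum_(i < \dim U) rt (a i.+1) * u ^+ (p ^ i).
Hypothesis b_deg : (0 < deg b)%N.
Hypothesis r_gt1 : (1 < r)%N.
Hypothesis b_r : (w + p * deg b = r)%N.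
Hypothesis g_deg : (0 < deg g)%N.
Hypothesis rg_deg : (r * deg g < p ^ 4)%N.
Hypothesis g_values : forall x, g.[x] \in set_exp (set_of_vspace U) v.
Hypothesis g_root : exists x, g.[x] = 0.

Let p_gt0 : (0 < p)%N. Proof. exact: prime_gt0. Qed.
Let w_gt0 : (0 < w)%N. Proof. by move: wv; case: (w) => //; rewrite mul0n; move: p_gt1; lia. Qed.
Let v_gt0 : (0 < v)%N. Proof. by move: wv; case: (v) => //; rewrite muln0; move: p_gt1; lia. Qed.

(** On U the annihilator is a0 u + (u b(u^v))^p. As u^(p-1) = (u^v)^w, it equals u h(u^v) with h =
    a0 + X^w b^p, so h vanishes at every nonzero value of g. *)
Lemma subspace_exp_equation : exists K : {poly F},
  [/\ coprimep K K^`(), (0 < deg K < p ^ 4)%N, K * g^`() = v%:R * (g * K^`()) &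
  K * ((a 0%N)%:P + g ^+ w * (b \Po g) ^+ p) = - ((a 0%N)%:P * (('X^(p ^ 4) - 'X) * K^`()))].
Proof.
pose h : {poly F} := (a 0%N)%:P + 'X^w * b ^+ p.
have b0 : b != 0 := deg_gt0_neq0 b_deg.
have dh : deg h = r.
  have d : deg ('X^w * b ^+ p) = r by rewrite deg_mulXn ?expf_neq0 // deg_expr.
  by rewrite /h addrC deg_add_eq d // deg_polyC ltnW.
have hg : h \Po g = (a 0%N)%:P + g ^+ w * (b \Po g) ^+ p.
  by rewrite /h comp_polyD comp_polyC comp_polyM comp_Xn_poly rmorphXn.
have h_roots x : g.[x] = 0 \/ h.[g.[x]] = 0.
  have /imsetP[u uU ->] := g_values x.
  have [->|u0] := eqVneq u 0; first by left; rewrite expr0n (gtn_eqF v_gt0).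
  right; apply: (mulfI u0); rewrite mulr0 /h hornerD hornerC hornerM hornerXn horner_exp mulrDr.
  have -> : u * ((u ^+ v) ^+ w * b.[u ^+ v] ^+ p) = (u * b.[u ^+ v]) ^+ p.
    by rewrite exprMn mulrA -exprM -exprS mulnC wv prednK.
  rewrite bE exprp_sum -[RHS](aU uU) big_ord_recl /= expn0 expr1 [u * _]mulrC; congr (_ + _).
  by apply: eq_bigr => i _; rewrite exprMn rtK -exprM -expnSr.
have dh' : v%:R * ('X * h^`()) = (a 0%N)%:P - h.
  have wv1 : (w * v)%:R = -1 :> {poly F} by apply: (natr_eqm1 charF); rewrite wv prednK.
  rewrite /h derivD derivC add0r derivM derivXn -[_ *+ w]mulr_natl (deriv_dvdp_expr charF _ (dvdnn p)).
  rewrite mulr0 addr0.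
  have -> : ('X^w : {poly F}) = 'X * 'X^(w.-1) by rewrite -exprS prednK.
  transitivity ((w * v)%:R * ('X * 'X^(w.-1) * b ^+ p)); first by rewrite natrM; ring.
  by rewrite wv1; ring.
have [||K [sepK /andP[K0 Kg] eqK logK]] :=
  value_set_log_deriv charF (isT : (0 < 4)%N) hq g_deg _ _ h_roots dh' a0 g_root.
- by rewrite dh.
- by rewrite dh.
exists K; split=> //; last by rewrite -hg.
rewrite K0; apply: leq_ltn_trans Kg (leq_ltn_trans _ rg_deg).
by rewrite leq_pmull // ltnW.
Qed.

End SubspaceExponent.

Theorem mvsp_on_vspace_exp K U v : (0 < v)%N -> (v %| p.-1)%N -> \dim K = 1%N -> (K * U <= U)%VS ->
  1 \in U -> \dim U = 2 \/ \dim U = 3 -> ~~ is_aspace U ->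
  (2 < #|set_exp (set_of_vspace U) v|)%N ->
  forall g : {poly F}, mvsp_on (set_exp (set_of_vspace U) v) g <->
    exists f : {poly F}, mvsp_on (set_of_vspace U) f /\ g = f ^+ v.
Proof.
move=> v0 vp K1 KU U1 dU naU; set S := set_exp _ _ => S2.
have vK : (v %| (p ^ \dim K).-1)%N by rewrite K1 expn1.
have vq : (v %| #|F|.-1)%N := dvdn_trans vK (pred_dim_dvd K).
have U0 : 0 \in set_of_vspace U by rewrite set_of_vspaceE mem0v.
have clU := exp_closed_vspace v0 vK KU.
have [r cS cA] := card_set_exp vq U0 clU; rewrite -/S in cS.
have cU := card_set_of_vspace U.
have r2 : (1 < r)%N by rewrite -ltnS -cS.
have P0 : (0 < p ^ \dim U)%N by rewrite expn_gt0 prime_gt0.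
have vr : (v * r = (p ^ \dim U).-1)%N by rewrite -cU cA.
move=> g; split=> [[mg vg]|[f [mf ->]]]; last exact: (mvsp_exp v0 cA cS mf).
have cg : #|value_set g| = r.+1 by rewrite vg.
have [g_deg _] := mvspE mg cg; rewrite hq => rg.
have gS x : g.[x] \in S by rewrite -vg; apply/value_setP; exists x.
have [x0 gx0] : exists x, g.[x] = 0.
  have : 0 \in S by apply/imsetP; exists 0; rewrite ?expr0n ?(gtn_eqF v0).
  by rewrite -vg => /value_setP[x ->]; exists x.
have [x1 gx1] : exists x, g.[x] = 1.
  have : 1 \in S by apply/imsetP; exists 1; rewrite ?expr1n // set_of_vspaceE.
  by rewrite -vg => /value_setP[x ->]; exists x.
have [w ew] := dvdnP vp; have {ew} wv : (w * v = p.-1)%N by rewrite ew.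
have w0 : (0 < w)%N by move: wv; case: (w) => //; rewrite mul0n; move: p_gt1; lia.
have g0 : g != 0 := deg_gt0_neq0 g_deg.
have dbg b : deg (b \Po g) = (deg b * deg g)%N by rewrite /deg size_comp_poly.
have vw1 u : u * (u ^+ v) ^+ w = u ^+ p :> F.
  by rewrite -exprM -exprS mulnC wv prednK // prime_gt0.
suff [H gH] : exists H : {poly F}, g %= H ^+ v.
  have [f ef] := eqp_expr_eq v0 gH gx1.
  exists f; split=> //; rewrite ef in mg cg.
  apply: (mvsp_of_exp v0 mg cg); last by rewrite cA.
  apply/subsetP => y /value_setP[x ->].
  have /imsetP[u uU eu] := gS x.
  by apply: (clU u) => //; rewrite -eu ef horner_exp.
have [a [a0 aD Ha]] := linearized_separable U.
case: dU => dU.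
  pose b : {poly F} := (rt (a 1%N))%:P + rt (a 2) *: 'X^w.
  have rt_neq0 x : x != 0 -> rt x != 0 by move=> x0'; rewrite /rt expf_neq0.
  rewrite dU in aD.
  (* If [a 1] were 0, the relation at u = 1 would give a0 = - a2, so the p^2-th power map would fix
     U pointwise; having p^2 elements, U would be a field. *)
  have a1 : a 1%N != 0.
    apply: contraNneq naU => a1.
    have aU u : u \in set_of_vspace U -> u ^+ (p ^ 2) = u.
      have E2 z : z \in set_of_vspace U -> a 0%N * z + a 2 * z ^+ (p ^ 2) = 0.
        move=> /Ha; rewrite dU !big_ord_recr big_ord0 /= a1 => <-.
        by rewrite expn0 expr1 mul0r add0r addr0.
      have := E2 1; rewrite set_of_vspaceE => /(_ U1); rewrite mulr1 expr1n mulr1 => /eqP.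
      rewrite addr_eq0 => /eqP e02 /E2 /eqP; rewrite e02 mulNr addrC subr_eq0 => /eqP.
      by move/(mulfI aD).
    apply/andP; split; first exact: has_algid1.
    apply/prodvP => x y xU yU.
    rewrite -set_of_vspaceE; apply: mem_subfield_expr; rewrite cU dU.
    - by rewrite -(expn0 p) ltn_exp2l.
    - exact: aU.
    by rewrite exprMn !aU // set_of_vspaceE.
  have db : deg b = w.
    have dX : deg (rt (a 2) *: 'X^w) = w by rewrite deg_scale ?rt_neq0 // /deg size_polyXn.
    by rewrite /b addrC deg_add_eq dX // deg_polyC.
  have bE u : u * b.[u ^+ v] = \sum_(i < \dim U) rt (a i.+1) * u ^+ (p ^ i).
    rewrite dU !big_ord_recr big_ord0 /= add0r expn0 expr1 expn1.
    by rewrite hornerD hornerC hornerZ hornerXn mulrDr -(vw1 u); ring.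
  have b_r : (w + p * deg b = r)%N.
    apply/eqP; rewrite -(eqn_pmul2l v0) vr dU db; apply/eqP.
    rewrite (_ : (v * (w + p * w) = w * v * p.+1)%N); last by ring.
    by rewrite wv predn_exp !big_ord_recr big_ord0 /=; congr (_ * _)%N; ring.
  have [||R [sepR dR logR eqR]] := subspace_exp_equation wv a0 Ha bE _ r2 b_r g_deg rg gS _.
  - by rewrite db.
  - by exists x0.
  have [ra1 ra2] := (rt_neq0 _ a1, rt_neq0 _ aD).
  exists R; apply: (subspace_values_dim2 charF rtK _ wv g0 a0 _ sepR dR logR eqR) => //.
  by apply: deg_gt0_neq0; rewrite dbg db muln_gt0 w0.
(* The exponents come from v w = p - 1 and v w (p + 1) = p^2 - 1: they turn u b(u^v) into a
   linearized expression in u. *)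
pose b : {poly F} := ((rt (a 1%N))%:P + rt (a 2) *: 'X^w) + rt (a 3) *: 'X^(w * p.+1).
have db : deg b = (w * p.+1)%N.
  have dX : deg (rt (a 3) *: 'X^(w * p.+1)) = (w * p.+1)%N.
    by rewrite deg_scale /deg ?size_polyXn // /rt expf_neq0 // -dU.
  rewrite /b addrC deg_add_eq dX //; apply: (@leq_ltn_trans w); last first.
    by rewrite -{1}[w]muln1 ltn_pmul2l // ltnS prime_gt0.
  apply: deg_add_le; first by rewrite deg_polyC.
  by rewrite -mul_polyC -[w]add0n; apply: deg_mul_le; rewrite ?deg_polyC // /deg size_polyXn.
have bE u : u * b.[u ^+ v] = \sum_(i < \dim U) rt (a i.+1) * u ^+ (p ^ i).
  rewrite dU !big_ord_recr big_ord0 /= add0r expn0 expr1 expn1.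
  rewrite /b !(hornerD, hornerC, hornerZ, hornerXn) !mulrDr.
  have -> : u * (rt (a 3) * u ^+ v ^+ (w * p.+1)) = rt (a 3) * u ^+ (p ^ 2).
    rewrite mulrCA -exprM -exprS; congr (_ * _ ^+ _).
    rewrite (_ : (v * (w * p.+1) = w * v * p.+1)%N); last by ring.
    by rewrite wv; move: p_gt1; case: (p) => // k _; rewrite !expnS expn0 /=; ring.
  by rewrite -(vw1 u); ring.
have b_r : (w + p * deg b = r)%N.
  apply/eqP; rewrite -(eqn_pmul2l v0) vr dU db; apply/eqP.
  rewrite (_ : (v * (w + p * (w * p.+1)) = w * v * (p * p.+1).+1)%N); last by ring.
  by rewrite wv predn_exp !big_ord_recr big_ord0 /=; congr (_ * _)%N; ring.
have bpos : (0 < deg b)%N by rewrite db muln_gt0 w0.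
have [|R [sepR dR logR eqR]] := subspace_exp_equation wv a0 Ha bE bpos r2 b_r g_deg rg gS _.
  by exists x0.
exists R; apply: (subspace_values_dim3 charF rtK _ wv g0 a0 _ sepR dR logR eqR) => //.
by apply: deg_gt0_neq0; rewrite dbg muln_gt0 bpos.
Qed.

End Subspaces.

Theorem theorem6p3 (p : nat) (hp : prime p)
    (F : finFieldType) (charFp : p \in [pchar F]) (hq : #|F| = (p ^ 4)%N)
    (k : nat) (hk0 : (0 < k)%N) (hk : (k %| 4)%N)
    (v : nat) (hv0 : (1 <= v)%N) (hv : (v %| p ^ k - 1)%N)
    (K : {subfield pPrimeCharType charFp}) (hK : \dim K = k)
    (U : {vspace pPrimeCharType charFp}) (hKU : (K * U <= U)%VS)
    (m : nat) (hm : \dim_K U = m)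
    (h1 : 1 \in U)
    (hUv : (2 < #|set_exp (set_of_vspace U) v|)%N) :
  (~~ is_aspace U ->
     forall g : {poly F},
       mvsp_on (set_exp (set_of_vspace U) v) g <->
       exists f : {poly F}, mvsp_on (set_of_vspace U) f /\ g = f ^+ v) /\
  (is_aspace U ->
     let E := subfield_gen charFp (set_exp (set_of_vspace U) v) in
     let e := \dim E in
     forall g : {poly F},
       mvsp_on (set_exp (set_of_vspace U) v) g <->
       exists f : {poly F}, mvsp_on (set_of_vspace E) f /\
         g = f ^+ (((p ^ e - 1) * v) %/ (p ^ (m * k) - 1))%N).
Proof.
have vK : (v %| (p ^ \dim K).-1)%N by rewrite hK -subn1.
have dKU : (\dim K %| \dim U)%N := field_module_dimS hKU.
have KU : (K <= U)%VS.
  by apply/subvP => x xK; rewrite -[x]mulr1; apply: subvP hKU _ (memv_mul xK h1).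
have dL := dim_fullv_prime charFp hq.
have dU4 : (\dim U <= 4)%N by rewrite -dL dimvS // subvf.
split=> [naU|aU].
  (* In dimension 4, U is the whole field; in dimension k it is K, which it contains because of 1.
     Both are fields. *)
  have ndU4 : \dim U <> 4%N.
    move=> dU; case/negP: naU.
    have -> : U = {:pPrimeCharType charFp}%VS by apply/eqP; rewrite eqEdim subvf dL dU.
    exact: valP (aspacef _).
  have ndUk : \dim U <> k.
    move=> dU; case/negP: naU.
    have <- : (K : {vspace _}) = U by apply/eqP; rewrite eqEdim KU dU hK leqnn.
    exact: valP K.
  have [k1 dU] : k = 1%N /\ (\dim U = 2 \/ \dim U = 3)%N.
    have U0 : (0 < \dim U)%N by apply: leq_trans (dimvS KU); rewrite adim_gt0.
    move: dKU; rewrite hK => dkU; have kU := dvdn_leq U0 dkU.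
    have lt3 : (\dim U <= 3)%N by rewrite -ltnS ltn_neqAle dU4 andbT; apply/eqP.
    exact: (small_dims hk0 dkU U0 lt3 ndUk).
  apply: (mvsp_on_vspace_exp hq hv0 _ _ hKU) => //; last by rewrite hK.
  by move: vK; rewrite hK k1 expn1.
have vU : (v %| (p ^ \dim U).-1)%N := dvdn_trans vK (dvdn_pred_expn p dKU).
have emk : (m * k = \dim U)%N by rewrite -hm -hK divnK.
move=> E e; rewrite emk !subn1.
exact: (mvsp_on_subfield_exp hq (U := ASpace aU) hv0 vU hUv).
Qed.
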